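(* Let $F$ be a nonempty face of the spectral scale $B$ contained in the boundary of $B$, and let $F_1\supset\cdots\supset F_k=F$ be its associated minimal exposed facial chain. Then there is a sequence $(s_1,\mathbf t_1),(s_2,\mathbf t_2),\dots,(s_k,\mathbf t_k)$ of spectral pairs such that, if $q_{s_2,\mathbf t_2}^{\pm},\dots,q_{s_k,\mathbf t_k}^{\pm}$ denote the cut down spectral interval projections in its associated facial complex, then $$F_1=\Psi([p_{s_1,\mathbf t_1}^-,p_{s_1,\mathbf t_1}^+])$$ and for $2\le i\le k$ $$F_i=\Psi([q_i^-,q_i^+])=\Psi(q_{i-1}^-)+\Psi([q_{s_i,\mathbf t_i}^-,q_{s_i,\mathbf t_i}^+]),$$ where $q_1^-=p_{s_1,\mathbf t_1}^-$ and, for $2\le i\le k$, $$q_i^-=p_{s_1,\mathbf t_1}^-+q_{s_2,\mathbf t_2}^-+\cdots+q_{s_i,\mathbf t_i}^-,\qquad q_i^+=p_{s_1,\mathbf t_1}^-+q_{s_2,\mathbf t_2}^-+\cdots+q_{s_{i-1},\mathbf t_{i-1}}^-+q_{s_i,\mathbf t_i}^+ .$$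
   Context: $M$ is a finite von Neumann algebra with a faithful normal tracial state $\tau$, $n$ is a positive integer, and $b_1,\dots,b_n\in M$ are self-adjoint. $M_1^+=\{a\in M:0\le a\le 1\}$, $\Psi(a)=(\tau(a),\tau(b_1a),\dots,\tau(b_na))$, and $B=\Psi(M_1^+)\subset\mathbb R^{n+1}$ (the spectral scale) is compact and convex. For projections $p\le q$ in $M$, $[p,q]=\{a\in M_1^+:p\le a\le q\}$. For nonzero $\mathbf t=(t_1,\dots,t_n)\in\mathbb R^n$, $b_{\mathbf t}=t_1b_1+\cdots+t_nb_n$. A spectral pair is a pair $(s,\mathbf t)$ with $s\in\mathbb R$ and $\mathbf t\in\mathbb R^n$ nonzero; $p_{s,\mathbf t}^+$ and $p_{s,\mathbf t}^-$ are the spectral projections of $b_{\mathbf t}$ for $(-\infty,s]$ and $(-\infty,s)$. Exposed faces: a nonempty face $G$ of a convex set $C$ in a Euclidean space is exposed if $G=C\cap P$ for a hyperplane $P$ of support for $C$ (a hyperplane meeting the boundary of $C$ with $C$ in one of its closed half-spaces). The minimal exposed facial chain of a face $F$ of $C$ is the unique strictly decreasing sequence $F_1\supset\cdots\supset F_k=F$ such that $F_1$ is the smallest exposed face of $C$ containing $F$ and, for $1<i\le k$, $F_i$ is the smallest exposed face of $F_{i-1}$ containing $F$. Cut down spectral interval projections: for a projection $r\in M$, self-adjoint $b\in M$ and $s\in\mathbb R$, these are the spectral projections of $rbr$, computed in $rMr$ (with unit $r$), for the intervals $(-\infty,s)$ (superscript $-$) and $(-\infty,s]$ (superscript $+$).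 Facial complex of a sequence $(s_1,\mathbf t_1),\dots,(s_k,\mathbf t_k)$ of spectral pairs, defined inductively: $r_1=p_{s_1,\mathbf t_1}^+-p_{s_1,\mathbf t_1}^-$; for $2\le i\le k$, $b_{\mathbf t_i}'=r_{i-1}b_{\mathbf t_i}r_{i-1}$, $q_{s_i,\mathbf t_i}^{\pm}$ are the cut down spectral interval projections determined by $b_{\mathbf t_i}$, $r_{i-1}$ and $s_i$, and (for $i<k$) $r_i=q_{s_i,\mathbf t_i}^+-q_{s_i,\mathbf t_i}^-$; the definition presupposes $r_1>r_2>\cdots>r_{k-1}$. The complex consists of $p_{s_1,\mathbf t_1}^{\pm}$, the $r_i$, the $b_{\mathbf t_i}'$ and the $q_{s_i,\mathbf t_i}^{\pm}$. *)

(* Defs.v *)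
From HB Require Import structures.
From mathcomp Require Import all_boot all_order all_algebra.
From mathcomp Require Import all_classical all_reals all_analysis.
From mathcomp Require Import complex.

Set Implicit Arguments.
Unset Strict Implicit.
Unset Printing Implicit Defensive.

Import Order.TTheory GRing.Theory Num.Theory.
Import numFieldNormedType.Exports.

Local Open Scope classical_set_scope.
Local Open Scope ring_scope.

(* Operators on a complex Hilbert space.  The space is a complete normed space
   H over R[i] together with a positive definite hermitian form, linear in its
   first argument, that induces the norm.  Operators are plain functions
   H -> H: sums and scalar multiples are pointwise, the product is \o and the
   unit is idfun. *)
Section operators.
Context {R : realType} {H : completeNormedModType R[i]}.
Variable dot : {dot H for @Num.conj R[i]}.
Implicit Types (a b p : H -> H) (M S : set (H -> H)).

Definition norm_from_dot : Prop := forall x : H, `|x| ^+ 2 = dot x x.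

Definition bounded_op : set (H -> H) := [set a | linear a /\ continuous a].

Definition adjoint_pair a b : Prop := forall x y, dot (a x) y = dot x (b y).

Definition selfadjoint a : Prop := adjoint_pair a a.

Definition pos_op a : Prop := forall x, 0 <= dot (a x) x.

Definition le_op a b : Prop := pos_op (b - a).

Definition commutant S : set (H -> H) :=
  [set x | bounded_op x /\ forall a, S a -> x \o a = a \o x].

(* Being a unital subalgebra follows from the double commutant condition. *)
Definition von_neumann_algebra M : Prop :=
  [/\ M `<=` bounded_op,
      forall a, M a -> exists2 b, M b & adjoint_pair a b
    & commutant (commutant M) = M].

Definition finite_algebra M : Prop :=
  forall v w, M v -> M w -> adjoint_pair v w -> w \o v = idfun ->
    v \o w = idfun.

(* Only the values of tau on M matter.  In [tr_normal], D is an upward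
   directed set of self-adjoint elements and a is its supremum in M; the order
   on R[i] is z <= w iff w - z is a nonnegative real. *)
Record faithful_normal_tracial_state M (tau : (H -> H) -> R[i]) : Prop := {
  tr_linear : forall (c : R[i]) a b, M a -> M b ->
    tau (c *: a + b) = c * tau a + tau b;
  tr_pos : forall a, M a -> pos_op a -> 0 <= tau a;
  tr_unit : tau idfun = 1;
  tr_trace : forall a b, M a -> M b -> tau (a \o b) = tau (b \o a);
  tr_faithful : forall a, M a -> pos_op a -> tau a = 0 -> a = 0;
  tr_normal : forall (D : set (H -> H)) a,
    D !=set0 -> D `<=` M -> (forall d, D d -> selfadjoint d) ->
    (forall d e, D d -> D e -> exists f, [/\ D f, le_op d f & le_op e f]) ->
    M a -> selfadjoint a -> (forall d, D d -> le_op d a) ->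
    (forall c, M c -> selfadjoint c -> (forall d, D d -> le_op d c) ->
      le_op a c) ->
    supremums (tau @` D) (tau a)
}.

Definition projection_in M p : Prop := [/\ M p, selfadjoint p & p \o p = p].

Definition corner M r : set (H -> H) := [set r \o a \o r | a in M].

(* E is the spectral measure of the self-adjoint element c of the algebra N
   with unit e: a projection-valued Borel measure with values in N and total
   mass e such that c is the integral of the identity function against E.
   Countable additivity and the integral are read off the scalar measures
   A |-> <E(A)x, x>. *)
Definition spectral_measure (N : set (H -> H)) (e c : H -> H)
    (E : set R -> H -> H) : Prop :=
  [/\ forall A : set (measurableTypeR R), measurable A ->
        projection_in N (E A),
      E setT = e
    & forall x : H, exists mu : {measure set (measurableTypeR R) -> \bar R},
        [/\ forall A, measurable A -> mu A = (complex.Re (dot (E A x) x))%:E,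
            mu.-integrable setT (fun l => (l : R)%:E)
          & \int[mu]_l (l : R)%:E = (complex.Re (dot (c x) x))%:E]%E].

(* The default value is irrelevant: the spectral measure exists and is unique
   on Borel sets by the spectral theorem. *)
Definition spectral_proj (N : set (H -> H)) (e c : H -> H) (A : set R) :
    H -> H :=
  xget (fun=> 0) [set E | spectral_measure N e c E] A.

Definition cut_minus M r b (s : R) : H -> H :=
  spectral_proj (corner M r) r (r \o b \o r) [set` `]-oo, s[].

Definition cut_plus M r b (s : R) : H -> H :=
  spectral_proj (corner M r) r (r \o b \o r) [set` `]-oo, s]].

Definition unit_interval_op M : set (H -> H) :=
  [set a | [/\ M a, pos_op a & le_op a idfun]].

Definition op_interval M p q : set (H -> H) :=
  [set a | [/\ unit_interval_op M a, le_op p a & le_op a q]].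

End operators.

Section convex_sets.
Context {R : realType} {m : nat}.
Implicit Types (C F G P : set 'rV[R]_m).

Definition dotrv (u v : 'rV[R]_m) : R := \sum_j u 0 j * v 0 j.

Definition boundary C : set 'rV[R]_m := closure C `\` interior C.

Definition face F C : Prop :=
  [/\ F `<=` C, convex_set F
    & forall x y (l : R), C x -> C y -> 0 < l < 1 ->
        F (l *: x + (1 - l) *: y) -> F x /\ F y].

Definition hyperplane (u : 'rV[R]_m) (c : R) : set 'rV[R]_m :=
  [set x | dotrv u x = c].

Definition support_hyperplane P C : Prop :=
  exists (u : 'rV[R]_m) (c : R),
    [/\ u != 0, P = hyperplane u c, P `&` boundary C !=set0
      & (C `<=` [set x | dotrv u x <= c]) \/ (C `<=` [set x | c <= dotrv u x])].

Definition exposed_face G C : Prop :=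
  [/\ face G C, G !=set0
    & exists2 P, support_hyperplane P C & G = C `&` P].

Definition smallest_exposed_face G C F : Prop :=
  [/\ exposed_face G C, F `<=` G
    & forall G', exposed_face G' C -> F `<=` G' -> G `<=` G'].

(* The chain is Fs 1, ..., Fs k; other values of Fs are irrelevant. *)
Definition minimal_exposed_chain C F (k : nat) (Fs : nat -> set 'rV[R]_m) :
    Prop :=
  [/\ (0 < k)%N, Fs k = F,
      smallest_exposed_face (Fs 1%N) C F
    & forall i, (1 < i <= k)%N ->
        smallest_exposed_face (Fs i) (Fs i.-1) F /\ Fs i `<` Fs i.-1].

End convex_sets.

Section spectral_scale.
Context {R : realType} {H : completeNormedModType R[i]}.
Variable dot : {dot H for @Num.conj R[i]}.
Variables (M : set (H -> H)) (tau : (H -> H) -> R[i]).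
Context {n : nat}.
Variable b : 'I_n -> H -> H.

(* The first coordinate is tau(a), the others are the tau(b_i a).  All are real
   when a and the b_i are self-adjoint, hence the use of Re. *)
Definition Psi (a : H -> H) : 'rV[R]_n.+1 :=
  \row_j (complex.Re (if unlift ord0 j is Some i then tau (b i \o a)
                      else tau a)).

Definition spectral_scale : set 'rV[R]_n.+1 :=
  Psi @` unit_interval_op dot M.

Definition comb (t : 'rV[R]_n) : H -> H :=
  \sum_(i < n) (real_complex R (t 0 i)) *: b i.

Definition p_minus (s : R) (t : 'rV[R]_n) : H -> H :=
  spectral_proj dot M idfun (comb t) [set` `]-oo, s[].

Definition p_plus (s : R) (t : 'rV[R]_n) : H -> H :=
  spectral_proj dot M idfun (comb t) [set` `]-oo, s]].

Definition spectral_pair (st : R * 'rV[R]_n) : Prop := st.2 != 0.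

(* Sequences of spectral pairs are indexed from 1, as are the r_i. *)
Variable st : nat -> R * 'rV[R]_n.

Fixpoint fc_r (i : nat) : H -> H :=
  match i with
  | 0%N => idfun
  | 1%N => p_plus (st 1%N).1 (st 1%N).2 - p_minus (st 1%N).1 (st 1%N).2
  | i'.+1 => cut_plus dot M (fc_r i') (comb (st i).2) (st i).1
             - cut_minus dot M (fc_r i') (comb (st i).2) (st i).1
  end.

Definition fc_qminus (i : nat) : H -> H :=
  cut_minus dot M (fc_r i.-1) (comb (st i).2) (st i).1.

Definition fc_qplus (i : nat) : H -> H :=
  cut_plus dot M (fc_r i.-1) (comb (st i).2) (st i).1.

(* st 1, ..., st k are spectral pairs with r_1 > r_2 > ... > r_(k-1), so that
   their facial complex is defined. *)
Definition has_facial_complex (k : nat) : Prop :=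
  (forall i, (1 <= i <= k)%N -> spectral_pair (st i)) /\
  (forall i, (1 <= i)%N -> (i.+1 < k)%N ->
     le_op dot (fc_r i.+1) (fc_r i) /\ fc_r i.+1 <> fc_r i).

Definition sum_qminus (i : nat) : H -> H :=
  p_minus (st 1%N).1 (st 1%N).2 + \sum_(2 <= j < i.+1) fc_qminus j.

Definition sum_qplus (i : nat) : H -> H :=
  p_minus (st 1%N).1 (st 1%N).2 + \sum_(2 <= j < i) fc_qminus j + fc_qplus i.

End spectral_scale.

(* Main.v *)
Require Import Defs.
From HB Require Import structures.
From mathcomp Require Import all_boot all_order all_algebra.
From mathcomp Require Import all_classical all_reals all_analysis.
From mathcomp Require Import measurable_realfun complex ring lra.

Set Implicit Arguments.
Unset Strict Implicit.
Unset Printing Implicit Defensive.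

Import Order.TTheory GRing.Theory Num.Theory.
Import numFieldNormedType.Exports.

Local Open Scope classical_set_scope.
Local Open Scope ring_scope.

(** The scale [B] and all faces of its chain have the shape
    [Psi Q + Psi [0, r]], where [r] is a projection of [M] and [[0, r]] is the
    set of all [a] in [M] with [0 <= a <= r]; for [B] itself, [Q = 0] and
    [r = 1].  A hyperplane that supports such a set minimizes a functional
    [a |-> tau ((b_t - s) a)] over [[0, r]].  Let [c = r b_t r], and let [qm]
    and [qp] be its spectral projections in the corner [r M r] for [l < s] and
    [l <= s].  Then [c - s = up - down] on the range of [r], where [up >= 0] is
    injective on the range of [r - qp], [down >= 0] is injective on that of
    [qm], and both vanish elsewhere.  The functional exceeds its value at [qm]
    by
      [tau (a up) + tau ((r - a) down)],
    a sum of two nonnegative numbers, and by faithfulness it vanishes exactly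
    when [qm <= a <= qp] ([shifted_trace_min], [shifted_trace_argmin],
    [shifted_trace_argminW]).  Thus the exposed face is [Psi Q + Psi [qm, qp]],
    which is [Psi (Q + qm) + Psi [0, qp - qm]], and the argument can be repeated
    with [qp - qm] in place of [r].  If the functional is a multiple of the
    trace, so that its [t] is zero, then the exposed face is a single point,
    and a nonzero [t] with [s] outside the spectrum yields it as well
    ([supported_slice]).  Strict inclusion of the faces makes the projections
    [r] strictly decreasing.

    For this the spectral projections have to exist, which takes a spectral
    theorem ([exists_spectral_measure]).  It is obtained from the real inner
    product [rdot].  Bounded monotone sequences of operators converge strongly
    ([monotone_limit]), which yields square roots ([exists_sqrt]) and
    projections onto kernels ([exists_kernel_proj]), and with them the spectral
    projections [E l] for [(-oo, l]] ([exists_spectral_cut]).  The functions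
    [l |-> <E l x, x>] define Stieltjes measures, and a Dynkin class argument
    produces the projections of all Borel sets ([borel_projections]).
    Conversely, the properties of the spectral projections that are needed
    ([cut_spec]) are derived for an arbitrary spectral measure
    ([spectral_measure_cut]): additivity makes it multiplicative, and since
    scalar measures of orthogonal pieces add up, [c] is reduced by the range of
    each projection.

    Positivity of [tau (a b)] for positive [a] and [b] does not go through
    square roots: the iteration [a |-> a - a^2] splits a positive contraction
    [a] into a sum of squares ([iter_square]), and this also shows that products
    of commuting positive operators are positive ([effect_mul_pos]). *)

(** * Elementary real inequalities *)

(** Otherwise the quadratic is negative at a small multiple of [- p]. *)
Lemma linear_coef_eq0 (R : realFieldType) (p q : R) :
  (forall t, 0 <= t * p *+ 2 + t ^+ 2 * q) -> p = 0.
Proof.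
move=> h; apply/eqP; apply/negP => /negP p0.
have q1 : 0 < `|q| + 1 by rewrite ltr_pwDr.
have := h (- p / (`|q| + 1)); apply/negP; rewrite -ltNge.
have -> : - p / (`|q| + 1) * p *+ 2 + (- p / (`|q| + 1)) ^+ 2 * q =
  (p ^+ 2 / (`|q| + 1) ^+ 2) * (q - `|q| *+ 2 - 2).
  by field; rewrite gt_eqF.
rewrite pmulr_rlt0; last by rewrite divr_gt0 ?exprn_even_gt0 //= gt_eqF.
have := ler_norm q; have := normr_ge0 q; lra.
Qed.

(** If [phi 0] were negative, a small [e] would make the penalty [e * C]
    harmless, and [psi] would drop by a fixed amount at every step.  Below,
    [phi n] is the quantity to be shown nonnegative after [n] squares have been
    split off, and [psi n] measures what is left of the operator that is being
    split. *)
Lemma telescoping_ge0 (R : realType) (phi psi : nat -> R) (C : R) :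
  (forall n, phi n.+1 <= phi n) -> (forall n, 0 <= psi n) -> 0 <= C ->
  (forall n e, 0 < e -> - ((psi n - psi n.+1) / e + e * C) <= phi n) ->
  0 <= phi 0%N.
Proof.
move=> phi_le psi0 C0 h; rewrite leNgt; apply/negP => phi0.
have phi_le0 n : phi n <= phi 0%N.
  by elim: n => // n; exact: le_trans (phi_le n).
pose e := - phi 0%N / (2 * (C + 1)).
have C1 : 0 < C + 1 by lra.
have e0 : 0 < e by rewrite divr_gt0 ?mulr_gt0 // oppr_gt0.
have eC : e * C <= - phi 0%N / 2.
  have -> : e * C = - phi 0%N / 2 * (C / (C + 1)).
    by rewrite /e; field; rewrite gt_eqF.
  rewrite ger_pMr; last by rewrite divr_gt0 // oppr_gt0.
  by rewrite ler_pdivrMr // mul1r lerDl.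
pose d := e * (- phi 0%N / 2).
have d0 : 0 < d by rewrite mulr_gt0 // divr_gt0 // oppr_gt0.
have step n : psi n.+1 <= psi n - d.
  have := h n e e0; have := phi_le0 n => h1 h2.
  have : - phi 0%N / 2 <= (psi n - psi n.+1) / e by lra.
  by rewrite ler_pdivlMr // mulrC -/d; lra.
have dec n : psi n <= psi 0%N - n%:R * d.
  elim: n => [|n IHn]; first by rewrite mul0r subr0.
  by apply: le_trans (step n) _; rewrite -natr1 mulrDl mul1r; lra.
pose n := (Num.trunc (psi 0%N / d)).+1.
have : psi 0%N < n%:R * d.
  rewrite -ltr_pdivrMr //; exact: truncnS_gt.
by have := dec n; have := psi0 n; lra.
Qed.

(** The Cauchy-Schwarz inequality of a nonnegative quadratic, in the linearized
    form that [telescoping_ge0] takes as a hypothesis. *)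
Lemma young_lower_bound (R : realType) (p q s e : R) : 0 < e ->
  (forall t : R, 0 <= p + t * s *+ 2 + t ^+ 2 * q) -> 0 <= p -> 0 <= q ->
  - (p / e + e * q) <= s.
Proof.
move=> e0 h p0 q0; have := h e.
have -> : p + e * s *+ 2 + e ^+ 2 * q = e * (p / e + s *+ 2 + e * q).
  by field; rewrite gt_eqF.
rewrite pmulr_rge0 // => h1.
have : 0 <= p / e by rewrite divr_ge0 // ltW.
have : 0 <= e * q by rewrite mulr_ge0 // ltW.
lra.
Qed.

(** Cutting [[a, b]] into [N] equal pieces bounds the increment of [h] by
    [(b - a) / N] times the increment of [F]. *)
Lemma second_order_const (R : realType) (h F : R -> R) (a b : R) : a <= b ->
  (forall s t, a <= s -> s <= t -> t <= b ->
     `|h t - h s| <= (t - s) * (F t - F s)) -> h b = h a.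
Proof.
move=> ab hF; apply/eqP; rewrite -subr_eq0 -normr_eq0.
set D := `|_|; apply/negP => /negP D0.
have Dgt0 : 0 < D by rewrite lt_def D0 normr_ge0.
pose C := (b - a) * (F b - F a).
have bound n : D * n.+1%:R <= C.
  pose d := (b - a) / n.+1%:R.
  have n0 : (0 : R) < n.+1%:R by rewrite ltr0n.
  have d0 : 0 <= d by rewrite divr_ge0 ?subr_ge0 // ltW.
  have step i : (i <= n.+1)%N -> a + i%:R * d <= b.
    move=> iN; rewrite -lerBrDl /d mulrA ler_pdivrMr // mulrC.
    by rewrite ler_wpM2l ?subr_ge0 // ler_nat.
  have acc i : (i <= n.+1)%N ->
      `|h (a + i%:R * d) - h a| <= d * (F (a + i%:R * d) - F a).
    elim: i => [_|i IH iN]; first by rewrite mul0r addr0 !subrr normr0 mulr0.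
    have ai : a <= a + i%:R * d by rewrite lerDl mulr_ge0.
    have := hF (a + i%:R * d) (a + i.+1%:R * d) ai.
    have -> : a + i.+1%:R * d - (a + i%:R * d) = d by rewrite -natr1; ring.
    have iS : a + i%:R * d <= a + i.+1%:R * d.
      by rewrite lerD2l ler_wpM2r // ler_nat.
    move=> /(_ iS (step _ iN)) h1; have h2 := IH (ltnW iN).
    have := ler_normD (h (a + i.+1%:R * d) - h (a + i%:R * d))
      (h (a + i%:R * d) - h a).
    by rewrite addrA subrK; nra.
  have := acc n.+1 (leqnn _).
  have -> : a + n.+1%:R * d = b by rewrite /d; field; rewrite gt_eqF.
  by rewrite /d -/D mulrAC ler_pdivlMr.
have := bound (Num.trunc (C / D)); have := truncnS_gt (C / D).
rewrite ltr_pdivrMr // mulrC; lra.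
Qed.

Lemma ge0_mul_lt_eq0 (R : realType) (m s k : R) :
  0 <= m -> s < k -> k * m <= s * m -> m = 0.
Proof.
move=> m0 sk km; have : (k - s) * m <= 0 by rewrite mulrBl subr_le0.
by rewrite pmulr_rle0 ?subr_gt0 // => m1; apply/eqP; rewrite eq_le m0 m1.
Qed.

(** * The underlying real Hilbert space *)

Section RealInner.
Local Open Scope complex_scope.
Context {R : realType} {H : completeNormedModType R[i]}.
Variable dot : {dot H for @Num.conj R[i]}.
Implicit Types (a b : H -> H) (x y z : H).

(** Quadratic forms and self-adjointness only depend on the real part of the
    hermitian form, which turns all of the spectral theory below into
    inequalities between real numbers. *)
Definition rdot x y : R := complex.Re (dot x y).

Lemma ReD (z w : R[i]) : complex.Re (z + w) = complex.Re z + complex.Re w.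
Proof. by case: z; case: w. Qed.

Lemma ReN (z : R[i]) : complex.Re (- z) = - complex.Re z.
Proof. by case: z. Qed.

Lemma ReM_real (k : R) (z : R[i]) : complex.Re (k%:C * z) = k * complex.Re z.
Proof. by case: z => u v /=; rewrite mul0r subr0. Qed.

Lemma Re_conj (z : R[i]) : complex.Re (Num.conj z) = complex.Re z.
Proof. by case: z. Qed.

Lemma rdotC x y : rdot x y = rdot y x.
Proof. by rewrite /rdot hermC /= expr0 mul1r Re_conj. Qed.

Lemma rdotDl x y z : rdot (x + y) z = rdot x z + rdot y z.
Proof. by rewrite /rdot linearDl ReD. Qed.

Lemma rdotNl x z : rdot (- x) z = - rdot x z.
Proof. by rewrite /rdot linearNl ReN. Qed.

Lemma rdotZl (k : R) x z : rdot (k%:C *: x) z = k * rdot x z.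
Proof. by rewrite /rdot linearZl_LR ReM_real. Qed.

Lemma rdotDr x y z : rdot z (x + y) = rdot z x + rdot z y.
Proof. by rewrite rdotC rdotDl !(rdotC _ z). Qed.

Lemma rdotNr x z : rdot z (- x) = - rdot z x.
Proof. by rewrite rdotC rdotNl rdotC. Qed.

Lemma rdotZr (k : R) x z : rdot z (k%:C *: x) = k * rdot z x.
Proof. by rewrite rdotC rdotZl rdotC. Qed.

Lemma rdot0l z : rdot 0 z = 0.
Proof. by rewrite /rdot linear0l. Qed.

Lemma rdot0r z : rdot z 0 = 0.
Proof. by rewrite rdotC rdot0l. Qed.

Definition rdotE := (rdotDl, rdotNl, rdotZl, rdotDr, rdotNr, rdotZr,
  rdot0l, rdot0r).

Lemma dot_diag x : dot x x = (rdot x x)%:C.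
Proof.
rewrite /rdot; have : 0 <= dot x x by exact: dnorm_ge0.
by case: (dot x x) => u v; rewrite lecE /= => /andP[/eqP-> _].
Qed.

Lemma rdot_ge0 x : 0 <= rdot x x.
Proof.
have : 0 <= dot x x by exact: dnorm_ge0.
by rewrite dot_diag lecE /= eqxx.
Qed.

Lemma rdot_eq0 x : rdot x x = 0 -> x = 0.
Proof.
move=> x0; apply/eqP; have := dnorm_eq0 dot x.
by rewrite dot_diag x0 eqxx => <-.
Qed.

Lemma rdot_diag_eq x y : rdot (x - y) (x - y) = 0 -> x = y.
Proof. by move=> /rdot_eq0/eqP; rewrite subr_eq0 => /eqP. Qed.

(** Hence a complex linear operator that is symmetric for [rdot] is
    self-adjoint. *)
Lemma Im_dot x y : complex.Im (dot x y) = rdot x ('i *: y).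
Proof.
rewrite /rdot linearZr_LR /=; case: (dot x y) => u v /=.
by rewrite !mul0r sub0r mulNr mul1r opprK.
Qed.

Lemma dotE x y : dot x y = (rdot x y) +i* (rdot x ('i *: y)).
Proof. by rewrite -Im_dot /rdot; case: (dot x y). Qed.

Lemma rdot_ext x y : (forall z, rdot x z = rdot y z) -> x = y.
Proof.
move=> h; apply: rdot_diag_eq; rewrite rdotDl rdotNl h subrr //.
Qed.

End RealInner.

(** * Norm, convergence and bounded operators *)

Section Operators.
Local Open Scope complex_scope.
Context {R : realType} {H : completeNormedModType R[i]}.
Variable dot : {dot H for @Num.conj R[i]}.
Hypothesis Hdot : norm_from_dot dot.
Implicit Types (a b c : H -> H) (x y z : H).

Local Notation rd := (rdot dot).

Lemma norm_rdot x : `|x| = (Num.sqrt (rd x x))%:C.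
Proof.
apply/eqP; rewrite -(@eqrXn2 _ 2%N) //; last by rewrite lecE /= eqxx sqrtr_ge0.
by rewrite Hdot dot_diag -rmorphXn /= sqr_sqrtr // rdot_ge0.
Qed.

Lemma gt0_real (e : R[i]) : 0 < e -> exists2 r : R, 0 < r & e = r%:C.
Proof. by case: e => u v; rewrite ltcE /= => /andP[/eqP-> u0]; exists u. Qed.

Lemma norm_lt_real x (r : R) : 0 < r -> (`|x| < r%:C) = (rd x x < r ^+ 2).
Proof.
move=> r0; rewrite norm_rdot ltcE /= eqxx /=.
by rewrite -[X in _ < X]gtr0_norm // -sqrtr_sqr ltr_sqrt ?exprn_gt0.
Qed.

Lemma cvg_rdotP (u : nat -> H) l :
  (forall e : R, 0 < e -> \forall n \near \oo, rd (l - u n) (l - u n) < e) ->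
  u @ \oo --> l.
Proof.
move=> h; apply/cvgrPdist_lt => e /gt0_real[r r0 ->].
have := h (r ^+ 2) (exprn_gt0 _ r0).
by apply: filterS => n; rewrite norm_lt_real.
Qed.

Lemma cvg_rdotW (u : nat -> H) l : u @ \oo --> l ->
  forall e : R, 0 < e -> \forall n \near \oo, rd (l - u n) (l - u n) < e.
Proof.
move=> /cvgrPdist_lt h e e0.
have s0 : 0 < Num.sqrt e by rewrite sqrtr_gt0.
have := h (Num.sqrt e)%:C; rewrite ltcE /= eqxx s0 => /(_ isT).
by apply: filterS => n; rewrite norm_lt_real // sqr_sqrtr // ltW.
Qed.

Lemma cauchy_rdot (u : nat -> H) :
  (forall e : R, 0 < e -> exists N, forall m n, (N <= m)%N -> (N <= n)%N ->
     rd (u m - u n) (u m - u n) < e) ->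
  exists l : H, u @ \oo --> l.
Proof.
move=> h; suff : cauchy (u @ \oo) by move/cauchy_cvgP/cvg_ex.
apply/cauchy_exP => e /gt0_real[r r0 ->].
have [N hN] := h (r ^+ 2) (exprn_gt0 _ r0).
exists (u N); exists N => // n /= Nn.
by rewrite -ball_normE /= norm_lt_real // hN.
Qed.

Lemma CauchySchwarz_rdot x y : rd x y ^+ 2 <= rd x x * rd y y.
Proof.
have [/rdot_eq0 -> |y0] := eqVneq (rd y y) 0;
  first by rewrite !rdotE expr0n mulr0.
have yy : 0 < rd y y by rewrite lt_def y0 rdot_ge0.
have := rdot_ge0 dot ((rd y y)%:C *: x - (rd x y)%:C *: y).
rewrite !rdotE (rdotC dot y x) => h.
rewrite -subr_ge0 -(pmulr_rge0 _ yy); move: h; congr (_ <= _); ring.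
Qed.

Lemma cvg_rdotl (u : nat -> H) l y : u @ \oo --> l ->
  (fun n => rd (u n) y : R) @ \oo --> rd l y.
Proof.
move=> ul; apply/cvgrPdist_lt => e e0.
have y1 : 0 < rd y y + 1 by rewrite ltr_wpDl ?rdot_ge0.
have := cvg_rdotW ul (divr_gt0 (exprn_gt0 2 e0) y1).
apply: filterS => n; rewrite ltr_pdivlMr // => h.
have -> : rd l y - rd (u n) y = rd (l - u n) y by rewrite !rdotE.
rewrite -(@ltr_pXn2r _ 2%N) ?nnegrE //; last exact: ltW.
rewrite real_normK ?num_real //; apply: le_lt_trans h.
apply: le_trans (CauchySchwarz_rdot _ _) _.
by rewrite ler_wpM2l ?rdot_ge0 // lerDl.
Qed.

Lemma cvg_rdotr (u : nat -> H) l y : u @ \oo --> l ->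
  (fun n => rd y (u n) : R) @ \oo --> rd y l.
Proof.
move=> ul; rewrite rdotC; under eq_fun do rewrite rdotC.
exact: cvg_rdotl.
Qed.

Section linear.
Variable a : H -> H.
Hypothesis la : linear a.

Lemma opD x y : a (x + y) = a x + a y.
Proof. by have := la 1 x y; rewrite !scale1r. Qed.

Lemma op0 : a 0 = 0.
Proof. by apply: (addrI (a 0)); rewrite -opD !addr0. Qed.

Lemma opZ k x : a (k *: x) = k *: a x.
Proof. by have := la k x 0; rewrite !addr0 op0 addr0. Qed.

Lemma opN x : a (- x) = - a x.
Proof. by rewrite -scaleN1r opZ scaleN1r. Qed.

Lemma opB x y : a (x - y) = a x - a y.
Proof. by rewrite opD opN. Qed.

Definition opE := (opD, opN, opZ, op0).
End linear.

Definition symmetric_op a := forall x y, rd (a x) y = rd x (a y).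

Lemma selfadjoint_symmetric a : selfadjoint dot a -> symmetric_op a.
Proof. by move=> sa x y; rewrite /rdot sa. Qed.

Lemma symmetric_selfadjoint a : linear a -> symmetric_op a ->
  selfadjoint dot a.
Proof.
move=> la sa x y; rewrite !(dotE dot) sa; congr (_ +i* _).
by rewrite sa (opZ la).
Qed.

(** Polarization along [x + 'i *: y]: the values of the form of a positive
    operator are real. *)
Lemma pos_symmetric a : linear a -> pos_op dot a -> symmetric_op a.
Proof.
move=> la pa.
have im x : rd (a x) ('i *: x) = 0.
  by have := pa x; rewrite (dotE dot) lecE /= => /andP[/eqP].
have iE x y : rd ('i *: x) ('i *: y) = rd x y.
  rewrite /rdot linearZl_LR linearZr_LR /=.
  by case: (dot x y) => u v /=; ring.
move=> x y; have := im (x + 'i *: y).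
rewrite !scalerDr !(opE la) !rdotE iE im [rd ('i *: a y) _]iE im scalerA.
rewrite -expr2 sqrCi scaleN1r rdotNr (rdotC _ (a y)); lra.
Qed.

Lemma pos_rdot a x : pos_op dot a -> 0 <= rd (a x) x.
Proof. by move=> /(_ x); rewrite (dotE dot) lecE /= => /andP[]. Qed.

Lemma rdot_pos a : linear a -> symmetric_op a -> (forall x, 0 <= rd (a x) x) ->
  pos_op dot a.
Proof.
move=> la sa pa x; have := symmetric_selfadjoint la sa x x => sx.
rewrite lecE /= -/(rd (a x) x) pa andbT.
have : Num.conj (dot (a x) x) = dot x (a x).
  by rewrite (hermC dot x) /= expr0 mul1r.
rewrite -sx; case: (dot (a x) x) => u v [] /= /eqP.
by rewrite eq_sym -addr_eq0 -mulr2n mulrn_eq0.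
Qed.

(** Cauchy-Schwarz for the semi-inner product of a positive operator. *)
Lemma pos_ker a x : linear a -> symmetric_op a ->
  (forall y, 0 <= rd (a y) y) -> rd (a x) x = 0 -> a x = 0.
Proof.
move=> la sa pa ax; apply: (@rdot_eq0 _ _ dot).
apply: (@linear_coef_eq0 _ _ (rd (a (a x)) (a x))) => t.
have := pa (x + t%:C *: a x).
rewrite !(opE la) !rdotE ax (sa (a x) x).
by congr (_ <= _); ring.
Qed.

Lemma cvg_linear (u : nat -> H) l a : continuous a -> u @ \oo --> l ->
  (a \o u) @ \oo --> a l.
Proof. by move=> ca ul; apply: continuous_cvg => //; exact: ca. Qed.

Lemma bounded_opP a : linear a ->
  (exists K : R, forall x, rd (a x) (a x) <= K * rd x x) -> bounded_op a.
Proof.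
move=> la [K hK]; split=> // x.
pose K1 := `|K| + 1.
have K0 : 0 < K1 by rewrite ltr_pwDr.
apply/cvgrPdist_lt => e /gt0_real[r r0 ->].
have s0 : 0 < r / K1 by rewrite divr_gt0.
apply/nbhs_normP; exists (r / K1)%:C; first by rewrite /= ltcE /= eqxx.
move=> y /=; rewrite !norm_lt_real // -(opB la) => h.
apply: le_lt_trans (hK _) _.
have : K * rd (x - y) (x - y) <= K1 ^+ 2 * rd (x - y) (x - y).
  rewrite ler_wpM2r ?rdot_ge0 // /K1.
  have := ler_norm K; have := normr_ge0 K; nra.
move/le_lt_trans; apply.
by rewrite mulrC -ltr_pdivlMr ?exprn_gt0 // -expr_div_n.
Qed.

Lemma bounded_op_bound a : bounded_op a ->
  exists2 K : R, 0 < K & forall x, rd (a x) (a x) <= K * rd x x.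
Proof.
move=> [la ca]; have h1 : \forall t \near (0 : H), `|a 0 - a t| < 1.
  by apply: (@cvgr_dist_lt _ _ _ _ _ _ _ (ca 0)).
move/nbhs_normP: h1 => [_ /gt0_real[r r0 ->] hr].
pose K := 4 / r ^+ 2.
have K0 : 0 < K by rewrite divr_gt0 ?exprn_gt0.
exists K => // x.
have [/(@rdot_eq0 _ _ dot) ->|x0] := eqVneq (rd x x) 0.
  by rewrite (op0 la) !rdotE mulr0.
have xx : 0 < rd x x by rewrite lt_def x0 rdot_ge0.
set s := Num.sqrt (rd x x).
have s0 : 0 < s by rewrite sqrtr_gt0.
have sE : rd x x = s ^+ 2 by rewrite sqr_sqrtr // ltW.
have t0 : 0 < r / (2 * s) by rewrite divr_gt0 ?mulr_gt0.
have hx : `|(r / (2 * s))%:C *: x| < r%:C.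
  rewrite norm_lt_real // !rdotE sE.
  have -> : r / (2 * s) * (r / (2 * s) * s ^+ 2) = r ^+ 2 / 4.
    by field; rewrite gt_eqF.
  have := exprn_gt0 2 r0; lra.
have := hr ((r / (2 * s))%:C *: x).
rewrite /= !sub0r (op0 la) sub0r !normrN (opZ la) => /(_ hx).
have -> : 1 = (1 : R)%:C :> R[i] by [].
rewrite norm_lt_real // !rdotE sE => h.
have -> : K * s ^+ 2 = (r / (2 * s) * (r / (2 * s)))^-1.
  by rewrite /K; field; rewrite !gt_eqF.
have tt0 := mulr_gt0 t0 t0.
apply: ltW; rewrite -[X in _ < X]mul1r ltr_pdivlMr //.
by move: h; rewrite expr1n mulrA mulrC.
Qed.

Lemma bounded_form_bound a : bounded_op a ->
  exists2 K : R, 0 <= K & forall x, `|rd (a x) x| <= K * rd x x.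
Proof.
move=> /bounded_op_bound[K K0 hK]; exists (K + 1) => [|x]; first by lra.
have h := hK x; have := rdot_ge0 dot x; have := rdot_ge0 dot (a x).
have := rdot_ge0 dot (a x + x); have := rdot_ge0 dot (a x - x).
rewrite !rdotE (rdotC _ x (a x)) => h1 h2 h3 h4.
by rewrite ler_norml; apply/andP; split; nra.
Qed.

End Operators.

(** * Positive contractions and their monotone limits *)

Section Effects.
Local Open Scope complex_scope.
Context {R : realType} {H : completeNormedModType R[i]}.
Variable dot : {dot H for @Num.conj R[i]}.
Hypothesis Hdot : norm_from_dot dot.
Implicit Types (a b c : H -> H) (x y z v : H).

Local Notation rd := (rdot dot).

Record positive_op a : Prop := {
  pos_lin : linear a;
  pos_sym : symmetric_op dot a;
  pos_ge0 : forall x, 0 <= rd (a x) x }.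

(** The operators [0 <= a <= 1]; effect is their name in quantum theory. *)
Record effect a : Prop := {
  eff_pos :> positive_op a;
  eff_le1 : forall x, rd (a x) x <= rd x x }.

(** [a - a^2 = a (1 - a) a + (1 - a) a (1 - a)]. *)
Lemma effect_sqr_le a x : effect a -> rd (a x) (a x) <= rd (a x) x.
Proof.
move=> ea; have [[la sa pa] ha] := ea.
have h1 := ha (a x); have h2 := pa (x - a x).
move: h2; rewrite (opB la) !rdotE => h2.
have := sa (a x) x; lra.
Qed.

Definition complement_square a : H -> H := fun x => a x - a (a x).

Lemma complement_square_effect a : effect a -> effect (complement_square a).
Proof.
move=> ea; have [[la sa pa] ha] := ea; split; first split.
- move=> k x y; rewrite /complement_square !la scalerBr.
  by rewrite opprD addrACA.
- by move=> x y; rewrite /complement_square !rdotE !sa.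
- move=> x; rewrite /complement_square !rdotE subr_ge0 (sa (a x) x).
  exact: effect_sqr_le.
- move=> x; rewrite /complement_square !rdotE (sa (a x) x).
  by have := rdot_ge0 dot (a x); have := ha x; lra.
Qed.

(** With [a_n := iter_square a n], the recursion [a_n = a_n^2 + a_(n+1)] writes
    [a] as a sum of squares, which makes it possible to multiply [a] with
    another positive operator. *)
Definition iter_square a n := iter n complement_square a.

Lemma iter_square_effect a n : effect a -> effect (iter_square a n).
Proof. by move=> ea; elim: n => //= n; exact: complement_square_effect. Qed.

Lemma iter_square_comm a b n : linear b -> (forall x, a (b x) = b (a x)) ->
  forall x, iter_square a n (b x) = b (iter_square a n x).
Proof.
move=> lb ab; elim: n => //= n IH x.
by rewrite /complement_square (opB lb) !IH.
Qed.

(** Splitting [a] into squares turns the form of [a b] into a sum of values of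
    the form of [b], up to a remainder that is controlled by Cauchy-Schwarz.
    A square root of [a] would give a shorter argument, but its construction
    in [exists_sqrt] rests on the present lemma. *)
Lemma effect_mul_pos a b x : effect a -> positive_op b ->
  (forall x, a (b x) = b (a x)) -> 0 <= rd (a (b x)) x.
Proof.
move=> ea [lb sb pb] ab.
have en n := iter_square_effect n ea.
have cn n := iter_square_comm n lb ab.
apply: (@telescoping_ge0 _ (fun n => rd (iter_square a n (b x)) x)
  (fun n => rd (iter_square a n x) x) (rd (b x) (b x))).
- move=> n; rewrite /= /complement_square !rdotE gerDl oppr_le0.
  rewrite (pos_sym (en n) (iter_square a n (b x)) x) cn; exact: pb.
- by move=> n; exact: pos_ge0 (en n) _.
- exact: rdot_ge0.
move=> n e e0; rewrite /= /complement_square !rdotE.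
have sn := pos_sym (en n); rewrite (sn (iter_square a n x) x) (sn (b x) x).
rewrite subKr (rdotC dot (b x)).
apply: young_lower_bound => //; try exact: rdot_ge0.
move=> t; have := rdot_ge0 dot (iter_square a n x + t%:C *: b x).
rewrite !rdotE (rdotC dot _ (b x)); congr (_ <= _); ring.
Qed.

Lemma positive_scale (k : R) a : 0 <= k -> positive_op a ->
  positive_op (fun x => k%:C *: a x).
Proof.
move=> k0 [la sa pa]; split.
- by move=> r x y; rewrite la scalerDr !scalerA mulrC.
- by move=> x y; rewrite !rdotE sa.
- by move=> x; rewrite rdotE mulr_ge0.
Qed.

(** ** Monotone limits *)

Lemma effect_bounded a : effect a -> bounded_op a.
Proof.
move=> ea; apply: (bounded_opP Hdot) (pos_lin ea) _.
exists 1 => x; rewrite mul1r; apply: le_trans (eff_le1 ea x).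
exact: effect_sqr_le.
Qed.

Section limit.
Variable (u : nat -> H -> H) (a : H -> H).
Hypothesis ua : forall x, (fun n => u n x) @ \oo --> a x.

Lemma limit_linear : (forall n, linear (u n)) -> linear a.
Proof.
move=> lu k x y.
have h : (fun n => k *: u n x + u n y) @ \oo --> k *: a x + a y.
  by apply: cvgD; [apply: cvgZ; [exact: cvg_cst|]|]; exact: ua.
have h' := ua (x := k *: x + y).
rewrite (_ : (fun n => _) = (fun n => k *: u n x + u n y)) in h'.
  exact: norm_cvg_unique h' h.
by apply/funext => n; rewrite lu.
Qed.

Lemma limit_symmetric : (forall n, symmetric_op dot (u n)) ->
  symmetric_op dot a.
Proof.
move=> su x y; have h1 := cvg_rdotl Hdot (y := y) (ua (x := x)).
have h2 := cvg_rdotr Hdot (y := x) (ua (x := y)).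
rewrite (_ : (fun n => _) = (fun n => rd x (u n y))) in h1.
  exact: norm_cvg_unique h1 h2.
by apply/funext => n; rewrite su.
Qed.

Lemma limit_rdot_le x (k : R) :
  (\forall n \near \oo, rd (u n x) x <= k) -> rd (a x) x <= k.
Proof. exact: cvgr_to_le (cvg_rdotl Hdot (y := x) (ua (x := x))). Qed.

Lemma limit_rdot_ge x (k : R) :
  (\forall n \near \oo, k <= rd (u n x) x) -> k <= rd (a x) x.
Proof. exact: cvgr_to_ge (cvg_rdotl Hdot (y := x) (ua (x := x))). Qed.

Lemma limit_effect : (forall n, effect (u n)) -> effect a.
Proof.
move=> eu; split; first split.
- by apply: limit_linear => n; exact: pos_lin (eu n).
- by apply: limit_symmetric => n; exact: pos_sym (eu n).
- by move=> x; apply: limit_rdot_ge; apply: nearW => n; exact: pos_ge0 (eu n) _.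
- by move=> x; apply: limit_rdot_le; apply: nearW => n; exact: eff_le1 (eu n) _.
Qed.

Lemma limit_comm b : bounded_op b -> (forall n x, u n (b x) = b (u n x)) ->
  forall x, a (b x) = b (a x).
Proof.
move=> [lb cb] ub x; have h := cvg_linear cb (ua (x := x)).
have h' := ua (x := b x).
rewrite (_ : (fun n => _) = (fun n => b (u n x))) in h'.
  exact: norm_cvg_unique h' h.
by apply/funext => n; rewrite ub.
Qed.

End limit.

Lemma id_effect : effect idfun.
Proof. by split; first by split => // x; exact: rdot_ge0. Qed.

Lemma op_addE a b x : (a + b) x = a x + b x. Proof. by []. Qed.
Lemma op_subE a b x : (a - b) x = a x - b x. Proof. by []. Qed.
Lemma op_scaleE (k : R[i]) a x : (k *: a) x = k *: a x. Proof. by []. Qed.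

Lemma effect_compl a : effect a -> effect (idfun - a).
Proof.
move=> [[la sa pa] ha]; split; first split.
- move=> k x y; rewrite !op_subE /= la scalerBr; by rewrite opprD addrACA.
- by move=> x y; rewrite !op_subE !rdotE sa.
- by move=> x; rewrite op_subE !rdotE subr_ge0.
- by move=> x; rewrite op_subE !rdotE gerDl oppr_le0.
Qed.

Lemma effect_sub a b : effect a -> effect b ->
  (forall x, rd (b x) x <= rd (a x) x) -> effect (a - b).
Proof.
move=> [[la sa pa] ha] [[lb sb pb] hb] ba; split; first split.
- move=> k y z; rewrite !op_subE la lb scalerBr; by rewrite opprD addrACA.
- by move=> y z; rewrite !op_subE !rdotE sa sb.
- by move=> y; rewrite op_subE !rdotE subr_ge0.
- move=> y; rewrite op_subE !rdotE.
  by have := ha y; have := pb y; lra.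
Qed.

(** Monotone sequences of positive contractions converge strongly: for
    [m <= n] the difference [d] is a positive contraction, so that
    [|d x|^2 <= <d x, x>], and these scalars form a Cauchy sequence. *)
Lemma monotone_limit (u : nat -> H -> H) : (forall n, effect (u n)) ->
  (forall n x, rd (u n x) x <= rd (u n.+1 x) x) ->
  exists a, forall x, (fun n => u n x) @ \oo --> a x.
Proof.
move=> eu mono.
suff h x : exists l : H, (fun n => u n x) @ \oo --> l.
  by have [a ha] := choice h; exists a.
have homo x0 : {homo (fun n => rd (u n x0) x0) : m n / (m <= n)%N >-> m <= n}.
  by apply/nondecreasing_seqP => n; exact: mono.
have cvgf : cvgn (fun n => rd (u n x) x).
  apply: nondecreasing_is_cvgn => //.
  by exists (rd x x) => _ [n _ <-]; exact: eff_le1 (eu n) _.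
apply: (cauchy_rdot Hdot) => e e0.
have fle n : rd (u n x) x <= limn (fun n => rd (u n x) x).
  exact: nondecreasing_cvgn_le.
have /cvgrPdist_lt/(_ e e0)[N _ hN] : (fun n => rd (u n x) x : R) @ \oo -->
  limn (fun n => rd (u n x) x) by [].
have diff m n : (m <= n)%N -> (N <= m)%N ->
  rd (u n x - u m x) (u n x - u m x) < e.
  move=> mn Nm.
  have : effect (u n - u m).
    by apply: effect_sub => // y; exact: homo.
  move/(effect_sqr_le x)/le_lt_trans; apply.
  rewrite op_subE !rdotE.
  have := hN m Nm; rewrite /= ltr_norml => /andP[_ h].
  by have := fle n; lra.
exists N => m n Nm Nn; have [mn|nm] := leqP m n; last exact: diff (ltnW nm) Nn.
have := diff m n mn Nm; rewrite -(opprB (u m x)) rdotNl rdotNr opprK; exact.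
Qed.

End Effects.

(** * Commutants, square roots and kernel projections *)

Section Resolution.
Local Open Scope complex_scope.
Context {R : realType} {H : completeNormedModType R[i]}.
Variable dot : {dot H for @Num.conj R[i]}.
Hypothesis Hdot : norm_from_dot dot.
Implicit Types (a b : H -> H) (x y z v : H).

Local Notation rd := (rdot dot).

(** ** Commutants *)

Lemma bounded_id : bounded_op (idfun : H -> H).
Proof. by split => // x; exact: cvg_id. Qed.

Lemma bounded_add a b : bounded_op a -> bounded_op b -> bounded_op (a + b).
Proof.
move=> [la ca] [lb cb]; split.
- by move=> k x y; rewrite !op_addE la lb scalerDr addrACA.
- by move=> x; apply: cvgD; [exact: ca|exact: cb].
Qed.

Lemma bounded_scale (k : R[i]) a : bounded_op a -> bounded_op (k *: a).
Proof.
move=> [la ca]; split.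
- by move=> r x y; rewrite !op_scaleE la scalerDr !scalerA mulrC.
- by move=> x; apply: cvgZ; [exact: cvg_cst|exact: ca].
Qed.

Lemma bounded_comp a b : bounded_op a -> bounded_op b -> bounded_op (a \o b).
Proof.
move=> [la ca] [lb cb]; split; first by move=> k x y; rewrite /= lb la.
by move=> x; apply: continuous_comp; [exact: cb|exact: ca].
Qed.

Section commutant.
Variable S : set (H -> H).
Hypothesis bS : S `<=` bounded_op.

Lemma commutant_id : commutant S idfun.
Proof. by split; first exact: bounded_id. Qed.

Lemma commutantE a s x : commutant S a -> S s -> a (s x) = s (a x).
Proof. by move=> [_ h] /h/(congr1 (@^~ x)). Qed.

Lemma commutant_add a b : commutant S a -> commutant S b ->
  commutant S (a + b).
Proof.
move=> ca cb; split; first exact: bounded_add (proj1 ca) (proj1 cb).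
move=> s Ss; apply/funext => x /=; rewrite op_addE (commutantE _ ca Ss).
by rewrite (commutantE _ cb Ss) (opD (proj1 (bS Ss))).
Qed.

Lemma commutant_scale (k : R[i]) a : commutant S a -> commutant S (k *: a).
Proof.
move=> ca; split; first exact: bounded_scale (proj1 ca).
move=> s Ss; apply/funext => x /=; rewrite op_scaleE (commutantE _ ca Ss).
by rewrite (opZ (proj1 (bS Ss))).
Qed.

Lemma commutant_opp a : commutant S a -> commutant S (- a).
Proof. by rewrite -scaleN1r; exact: commutant_scale. Qed.

Lemma commutant_sub a b : commutant S a -> commutant S b ->
  commutant S (a - b).
Proof. by move=> ca cb; apply: commutant_add => //; exact: commutant_opp. Qed.

Lemma commutant_comp a b : commutant S a -> commutant S b ->
  commutant S (a \o b).
Proof.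
move=> ca cb; split; first exact: bounded_comp (proj1 ca) (proj1 cb).
move=> s Ss; apply/funext => x /=.
by rewrite (commutantE _ cb Ss) (commutantE _ ca Ss).
Qed.

Lemma commutant_limit (u : nat -> H -> H) a : bounded_op a ->
  (forall x, (fun n => u n x) @ \oo --> a x) ->
  (forall n, commutant S (u n)) -> commutant S a.
Proof.
move=> ba ua cu; split=> // s Ss; apply/funext => x /=.
apply: (limit_comm ua) (bS Ss) _ x.
by move=> n x; exact: commutantE (cu n) Ss.
Qed.

End commutant.

Lemma commutant_bounded S : commutant S `<=` (@bounded_op R H).
Proof. by move=> a []. Qed.

Section bicommutant.
Variable c : H -> H.
Hypothesis bc : bounded_op c.

(** For a self-adjoint [c] this is the von Neumann algebra generated by [c].  It
    is commutative, and all the operators constructed from [c] stay in it. *)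
Definition bicommutant : set (H -> H) := commutant (commutant [set c]).
Local Notation A := bicommutant.

Lemma bicommutant_gen : A c.
Proof. by split=> // a [_ /(_ c erefl)]. Qed.

Lemma bicommutant_comm a b x : A a -> A b -> a (b x) = b (a x).
Proof.
move=> Aa [bb Ab]; apply: commutantE Aa _; split=> // _ ->; apply: Ab.
by split=> // _ ->.
Qed.

Let bS : commutant [set c] `<=` (@bounded_op R H) := @commutant_bounded _.

Lemma bicommutant_id : A idfun.
Proof. exact: commutant_id. Qed.

Lemma bicommutant_add a b : A a -> A b -> A (a + b).
Proof. exact: (commutant_add bS). Qed.

Lemma bicommutant_sub a b : A a -> A b -> A (a - b).
Proof. exact: (commutant_sub bS). Qed.

Lemma bicommutant_scale k a : A a -> A (k *: a).
Proof. exact: (commutant_scale bS). Qed.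

Lemma bicommutant_comp a b : A a -> A b -> A (a \o b).
Proof. exact: commutant_comp. Qed.

Lemma bicommutant_limit (u : nat -> H -> H) a : effect dot a ->
  (forall x, (fun n => u n x) @ \oo --> a x) ->
  (forall n, A (u n)) -> A a.
Proof. by move=> ea; apply: (commutant_limit bS); exact: effect_bounded. Qed.

(** [u n (u n x - a x)] is not longer than [u n x - a x]. *)
Lemma square_limit (u : nat -> H -> H) a :
  (forall n, effect dot (u n)) -> (forall x, (fun n => u n x) @ \oo --> a x) ->
  forall x, (fun n => u n (u n x)) @ \oo --> a (a x).
Proof.
move=> eu ua x.
have h0 : (fun n => u n (u n x - a x)) @ \oo --> (0 : H).
  apply: (cvg_rdotP Hdot) => e e0.
  have := cvg_rdotW Hdot (ua x) e0; apply: filterS => n.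
  apply: le_lt_trans; rewrite sub0r !rdotE opprK.
  apply: le_trans (effect_sqr_le _ (eu n)) _.
  apply: le_trans (eff_le1 (eu n) _) _.
  by rewrite !rdotE; lra.
rewrite (_ : (fun n => _) = (fun n => u n (a x) + u n (u n x - a x))).
  by rewrite -[a (a x)]addr0; apply: cvgD.
apply/funext => n.
by rewrite -(opD (pos_lin (eu n))) addrC subrK.
Qed.

Lemma positive_add a b : positive_op dot a -> positive_op dot b ->
  positive_op dot (a + b).
Proof.
move=> [la sa pa] [lb sb pb]; split.
- by move=> k y z; rewrite !op_addE la lb scalerDr addrACA.
- by move=> y z; rewrite !op_addE !rdotE sa sb.
- by move=> y; rewrite op_addE rdotDl addr_ge0.
Qed.

(** Squaring is monotone on commuting positive operators, because
    [b^2 - a^2 = (b - a)(b + a)]. *)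
Lemma square_mono a b : effect dot a -> effect dot b ->
  (forall x, a (b x) = b (a x)) -> (forall x, rd (a x) x <= rd (b x) x) ->
  forall x, rd (a (a x)) x <= rd (b (b x)) x.
Proof.
move=> ea eb ab leab x.
have comm y : (b - a) ((b + a) y) = (b + a) ((b - a) y).
  rewrite !op_subE !op_addE !(opB (pos_lin ea)) !(opB (pos_lin eb)).
  rewrite !(opD (pos_lin ea)) !(opD (pos_lin eb)) !ab !opprD.
  by rewrite addrACA.
have := effect_mul_pos x (effect_sub eb ea leab) (positive_add eb ea) comm.
rewrite op_subE op_addE (opD (pos_lin ea)) (opD (pos_lin eb)) ab.
rewrite !rdotDl rdotNl rdotDl; lra.
Qed.

Section sqrt.
Variable a : H -> H.
Hypothesis (Aa : A a) (ea : effect dot a).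

(** The increasing iteration [z' = (1 - a + z^2) / 2], whose limit satisfies
    [(1 - z)^2 = a]. *)
Fixpoint sqrt_iter n : H -> H :=
  if n is m.+1 then (2^-1 : R)%:C *: (idfun - a + (sqrt_iter m \o sqrt_iter m))
  else 0.

Lemma sqrt_iterS n x : sqrt_iter n.+1 x =
  (2^-1 : R)%:C *: (x - a x + sqrt_iter n (sqrt_iter n x)).
Proof. by []. Qed.

Lemma sqrt_iter_mem n : A (sqrt_iter n).
Proof.
elim: n => [|n IH] /=.
  by rewrite -(subrr idfun); apply: bicommutant_sub; exact: bicommutant_id.
apply/bicommutant_scale/bicommutant_add; last exact: bicommutant_comp.
by apply: bicommutant_sub => //; exact: bicommutant_id.
Qed.

Lemma sqrt_iter_effect n : effect dot (sqrt_iter n).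
Proof.
elim: n => [|n [[ln sn pn] hn]].
  split; first split => //.
  - by move=> k x y; rewrite /= scaler0 addr0.
  - by move=> x y; rewrite /= rdot0l rdot0r.
  - by move=> x; rewrite /= rdot0l.
  - by move=> x; rewrite /= rdot0l rdot_ge0.
have [[la sa pa] ha] := ea; have eE := sqrt_iterS n.
split; first split.
- exact: (proj1 (proj1 (sqrt_iter_mem n.+1))).
- by move=> x y; rewrite !eE !rdotE sa !sn.
- move=> x; rewrite eE !rdotE (sn (sqrt_iter n x)).
  by have := ha x; have := rdot_ge0 dot (sqrt_iter n x); lra.
- move=> x; rewrite eE !rdotE (sn (sqrt_iter n x)).
  have := pa x; have := hn x.
  have := effect_sqr_le x (Build_effect (Build_positive_op ln sn pn) hn); lra.
Qed.

Lemma sqrt_iter_mono n x : rd (sqrt_iter n x) x <= rd (sqrt_iter n.+1 x) x.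
Proof.
elim: n x => [|n IH] x; first by rewrite /= rdot0l;
  exact: pos_ge0 (sqrt_iter_effect 1) _.
rewrite (sqrt_iterS n.+1) (sqrt_iterS n) !rdotZl !(rdotDl dot (x - a x)).
rewrite ler_pM2l ?invr_gt0 // lerD2l; apply: square_mono IH x => //.
- exact: sqrt_iter_effect.
- exact: sqrt_iter_effect.
by move=> y; apply: bicommutant_comm; exact: sqrt_iter_mem.
Qed.

Lemma exists_sqrt : exists w, [/\ A w, effect dot w & forall x, w (w x) = a x].
Proof.
have [z zE] := monotone_limit Hdot sqrt_iter_effect sqrt_iter_mono.
have ez := limit_effect Hdot zE sqrt_iter_effect.
have Az : A z := bicommutant_limit ez zE sqrt_iter_mem.
exists (idfun - z); split.
- by apply: bicommutant_sub => //; exact: bicommutant_id.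
- exact: effect_compl.
move=> x.
have h1 : (fun n => sqrt_iter n.+1 x) @ \oo --> z x.
  by have := zE x; rewrite -(cvg_shiftS (fun n => sqrt_iter n x)).
have h2 : (fun n => sqrt_iter n.+1 x) @ \oo -->
    (2^-1 : R)%:C *: (x - a x + z (z x)).
  apply: cvgZ; first exact: cvg_cst.
  apply: cvgD; first exact: cvg_cst.
  exact: (square_limit sqrt_iter_effect zE).
have h12 : z x = (2^-1 : R)%:C *: (x - a x + z (z x)).
  exact: norm_cvg_unique h1 h2.
have := congr1 ( *:%R (2 : R)%:C) h12; rewrite scalerA -rmorphM /=.
rewrite mulfV ?pnatr_eq0 // rmorph1 scale1r => h.
rewrite !op_subE /= (opB (pos_lin ez)).
have {}h : z x + z x = x - a x + z (z x).
  by rewrite -h (natrD _ 1 1) rmorphD rmorph1 scalerDl scale1r.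
by rewrite opprB addrACA -opprD h opprD addrACA subKr subrr addr0.
Qed.

End sqrt.

Section kernel.
Variable a : H -> H.
Hypothesis (Aa : A a) (ea : effect dot a).

Definition compl_pow n : H -> H := fun x => iter n (idfun - a) x.

Lemma compl_powS n x : compl_pow n.+1 x = compl_pow n x - a (compl_pow n x).
Proof. by []. Qed.

Lemma compl_pow_mem n : A (compl_pow n).
Proof.
elim: n => [|n IH]; first exact: bicommutant_id.
apply: (bicommutant_comp (a := idfun - a)) => //.
by apply: bicommutant_sub => //; exact: bicommutant_id.
Qed.

Lemma compl_pow_effect n : effect dot (compl_pow n).
Proof.
elim: n => [|n en]; first exact: id_effect.
have comm b x : A b -> b (compl_pow n x) = compl_pow n (b x).
  by move=> Ab; apply: bicommutant_comm => //; exact: compl_pow_mem.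
have [[la sa pa] ha] := ea; have [[lu su pu] hu] := en; split; first split.
- exact: (proj1 (proj1 (compl_pow_mem n.+1))).
- move=> x y; rewrite !compl_powS !rdotDl !rdotNl !rdotDr !rdotNr.
  by rewrite (su x y) (sa (compl_pow n x) y) (su x (a y)) (comm a y).
- move=> x; apply: (@effect_mul_pos _ _ dot (idfun - a) (compl_pow n)) => //.
    exact: effect_compl.
  move=> y; apply: comm.
  by apply: bicommutant_sub => //; exact: bicommutant_id.
- move=> x; rewrite compl_powS rdotDl rdotNl; apply: le_trans (hu x).
  rewrite gerDl oppr_le0; apply: effect_mul_pos => // y; exact: comm.
Qed.

(** The projection onto the kernel of [a] is the strong limit of the
    decreasing powers of [1 - a]. *)
Lemma exists_kernel_proj : exists p,
  [/\ A p, effect dot p, forall x, a (p x) = 0,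
      forall x, a x = 0 -> p x = x
    & forall b, bounded_op b -> (forall x, b (a x) = 0) ->
        forall x, b (p x) = b x].
Proof.
pose u n := idfun - compl_pow n.
have eu n : effect dot (u n) by apply: effect_compl; exact: compl_pow_effect.
have mono n x : rd (u n x) x <= rd (u n.+1 x) x.
  rewrite /u !op_subE compl_powS !rdotDl !rdotNl rdotDl rdotNl opprD opprK
    addrA.
  rewrite lerDl; apply: effect_mul_pos => //; first exact: compl_pow_effect.
  by move=> y; apply: bicommutant_comm => //; exact: compl_pow_mem.
have [q uq] := monotone_limit Hdot eu mono.
have eq_ := limit_effect Hdot uq eu.
have up x : (fun n => compl_pow n x) @ \oo --> (idfun - q) x.
  rewrite (_ : (fun n => _) = (fun n => x - u n x)).
    by apply: cvgB; [exact: cvg_cst|exact: uq].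
  by apply/funext => n; rewrite /u op_subE /= subKr.
have ep := effect_compl eq_.
exists (idfun - q); split => //.
- exact: bicommutant_limit ep up compl_pow_mem.
- move=> x; have [la ca] := effect_bounded Hdot ea.
  have h1 : (fun n => compl_pow n.+1 x) @ \oo --> (idfun - q) x.
    by have := up x; rewrite -(cvg_shiftS (fun n => compl_pow n x)).
  have h2 : (fun n => compl_pow n.+1 x) @ \oo -->
      (idfun - q) x - a ((idfun - q) x).
    have h3 : (fun n => a (compl_pow n x)) @ \oo --> a ((idfun - q) x).
      exact: cvg_linear ca (up x).
    exact: cvgB (up x) h3.
  have h12 : (idfun - q) x = (idfun - q) x - a ((idfun - q) x).
    exact: norm_cvg_unique h1 h2.
  by move/eqP: h12; rewrite eq_sym -subr_eq0 addrAC subrr sub0r oppr_eq0 =>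
    /eqP.
- move=> x ax; have cst n : compl_pow n x = x.
    by elim: n => // n IH; rewrite compl_powS IH ax subr0.
  have h : (fun n => compl_pow n x) @ \oo --> x.
    by rewrite (_ : (fun n => _) = (fun _ => x));
      [exact: cvg_cst|apply/funext => n; exact: cst].
  exact: norm_cvg_unique (up x) h.
move=> b [lb cb] ba x; have cst n : b (compl_pow n x) = b x.
  by elim: n => // n IH; rewrite compl_powS (opB lb) ba subr0.
have h1 := cvg_linear cb (up x).
have h2 : (fun n => b (compl_pow n x)) @ \oo --> b x.
  by rewrite (_ : (fun n => _) = (fun _ => b x));
      [exact: cvg_cst|apply/funext => n; exact: cst].
exact: norm_cvg_unique h1 h2.
Qed.

End kernel.
End bicommutant.
End Resolution.

(** * The spectral resolution of a self-adjoint operator *)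

Section Cut.
Local Open Scope complex_scope.
Context {R : realType} {H : completeNormedModType R[i]}.
Variable dot : {dot H for @Num.conj R[i]}.
Hypothesis Hdot : norm_from_dot dot.
Implicit Types (a b : H -> H) (x y z v : H).

Local Notation rd := (rdot dot).

Variable c : H -> H.
Hypothesis (bc : bounded_op c) (sc : symmetric_op dot c).
Local Notation A := (bicommutant c).

Lemma positive_square b : linear b -> symmetric_op dot b ->
  positive_op dot (b \o b).
Proof.
move=> lb sb; split; first by move=> k x y; rewrite /= !lb.
- by move=> x y /=; rewrite !sb.
- by move=> x /=; rewrite sb rdot_ge0.
Qed.

(** Scale [c - l] to a contraction [e] and let [w] be the square root of [e^2].
    As [(w - e) (w + e) = 0], the form of [e] is that of [- w] on the kernel of
    [w + e], and that of [w] on its orthogonal complement. *)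
Lemma exists_spectral_cut (l : R) : exists p,
  [/\ A p, effect dot p, forall x, p (p x) = p x,
      forall v, p v = v -> rd (c v) v <= l * rd v v
    & forall v, p v = 0 -> v != 0 -> l * rd v v < rd (c v) v].
Proof.
pose d := c - l%:C *: idfun.
have dE x : d x = c x - l%:C *: x by [].
have Ad : A d.
  apply: bicommutant_sub (bicommutant_gen bc) _.
  exact/bicommutant_scale/bicommutant_id.
have [ld _] := proj1 Ad.
have sd : symmetric_op dot d.
  by move=> x y; rewrite !dE !rdotE sc.
clearbody d.
have [K K0 hK] := bounded_op_bound Hdot (proj1 Ad).
pose k := (Num.sqrt K)^-1.
have k0 : 0 < k by rewrite invr_gt0 sqrtr_gt0.
have k2 : k * k * K = 1.
  have s0 : Num.sqrt K != 0 by rewrite gt_eqF // sqrtr_gt0.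
  have sK : K = Num.sqrt K ^+ 2 by rewrite sqr_sqrtr // ltW.
  by rewrite [X in _ * X]sK /k; field.
pose e := k%:C *: d.
have eE x : e x = k%:C *: d x by [].
have Ae : A e by exact: bicommutant_scale.
clearbody e.
have [le_ _] := proj1 Ae.
have se : symmetric_op dot e by move=> x y; rewrite !eE !rdotE sd.
have e1 x : rd (e x) (e x) <= rd x x.
  rewrite !eE !rdotE mulrA.
  have := ler_wpM2l (ltW (mulr_gt0 k0 k0)) (hK x).
  by rewrite [in leRHS]mulrA k2 mul1r.
have ea : effect dot (e \o e).
  by split; [exact: positive_square|move=> x /=; rewrite se].
have Aee : A (e \o e) by exact: bicommutant_comp.
have [w [Aw ew wE]] := exists_sqrt Hdot bc Aee ea.
have [[lw sw pw] hw] := ew.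
pose y0 := w + e.
have y0E x : y0 x = w x + e x by [].
have Ay0 : A y0 by exact: bicommutant_add.
clearbody y0.
have [ly0 _] := proj1 Ay0.
have sy0 : symmetric_op dot y0 by move=> x y; rewrite !y0E !rdotE sw se.
pose y := (4^-1 : R)%:C *: (y0 \o y0).
have yE x : y x = (4^-1 : R)%:C *: y0 (y0 x) by [].
have Ay : A y by exact/bicommutant_scale/bicommutant_comp.
have ey : effect dot y.
  split.
    apply: (@positive_scale _ _ dot 4^-1 (y0 \o y0)); first by rewrite invr_ge0.
    exact: positive_square.
  move=> x; rewrite yE rdotZl sy0 y0E.
  have := rdot_ge0 dot (w x - e x).
  have := e1 x; have := effect_sqr_le x ew; have := hw x.
  by rewrite !rdotE (rdotC dot (e x) (w x)); lra.
have ycomm : forall x, w (e x) = e (w x).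
  by move=> x; exact: bicommutant_comm Aw Ae.
have [p [Ap ep yp py bp]] := exists_kernel_proj Hdot bc Ay ey.
have yker x : y x = 0 -> w x = - e x.
  move=> yx0; have : rd (y x) x = 0 by rewrite yx0 rdot0l.
  rewrite yE rdotZl sy0 => /eqP; rewrite mulf_eq0 invr_eq0 pnatr_eq0 /=.
  by move=> /eqP/rdot_eq0/eqP; rewrite y0E addr_eq0 => /eqP.
have ce v : rd (c v) v - l * rd v v = rd (e v) v / k.
  by rewrite eE !rdotE dE !rdotE; field; rewrite gt_eqF.
have we v : p v = 0 -> w v = e v.
  move=> pv; have bwe : bounded_op (w - e).
    exact: (proj1 (bicommutant_sub Aw Ae)).
  have wey0 x : (w - e) (y0 x) = 0.
    rewrite op_subE y0E (opD lw) (opD le_) wE ycomm /=.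
    by rewrite [e (w x) + _]addrC subrr.
  have wey x : (w - e) (y x) = 0.
    by rewrite yE (opZ (proj1 bwe)) wey0 scaler0.
  have := bp (w - e) bwe wey v; rewrite pv op0; last exact: (proj1 bwe).
  by move/eqP; rewrite op_subE eq_sym subr_eq0 => /eqP.
have kV : 0 < k^-1 by rewrite invr_gt0.
exists p; split=> //.
- by move=> x; exact: py.
- move=> v pv; have /yker wv : y v = 0 by rewrite -pv yp.
  rewrite -subr_le0 ce pmulr_lle0 // -[e v]opprK -wv rdotNl oppr_le0; exact: pw.
move=> v pv v0; rewrite -subr_gt0 ce pmulr_lgt0 // -we // lt_def pw andbT.
apply: contra_neq v0 => wv.
have w0 : w v = 0 by apply: (@pos_ker _ _ dot).
have y0v : y0 v = 0 by rewrite y0E -we // w0 addr0.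
have y00 : y v = 0 by rewrite yE y0v (op0 ly0) scaler0.
by rewrite -(py v y00) pv.
Qed.

End Cut.

Section SpectralFamily.
Local Open Scope complex_scope.
Context {R : realType} {H : completeNormedModType R[i]}.
Variable dot : {dot H for @Num.conj R[i]}.
Hypothesis Hdot : norm_from_dot dot.
Implicit Types (a b : H -> H) (x y z v : H) (l : R).

Local Notation rd := (rdot dot).

Record proj_of (A : set (H -> H)) p : Prop := {
  proj_mem : A p;
  proj_eff : effect dot p;
  proj_idem : forall x, p (p x) = p x }.

Lemma proj_rdot A p x : proj_of A p -> rd (p x) (p x) = rd (p x) x.
Proof.
move=> [_ [[_ sp _] _] pp]; by rewrite -(sp (p x)) pp.
Qed.

(** On the range of [p], the form of [p] already exhausts the identity. *)
Lemma proj_orth A p q x : proj_of A p -> proj_of A q ->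
  (forall y, rd (p y) y + rd (q y) y <= rd y y) -> q (p x) = 0.
Proof.
move=> hp hq pq; apply: (@rdot_eq0 _ _ dot).
have := pq (p x); rewrite (proj_idem hp) (proj_rdot _ hq) gerDl => h.
have := rdot_ge0 dot (q (p x)); rewrite (proj_rdot _ hq); lra.
Qed.

Variable c : H -> H.
Hypothesis (bc : bounded_op c) (sc : symmetric_op dot c).
Local Notation A := (bicommutant c).

Section family.
Variable E : R -> H -> H.
Hypothesis EP : forall l, proj_of A (E l).
Hypothesis E_le : forall l v, E l v = v -> rd (c v) v <= l * rd v v.
Hypothesis E_gt : forall l v, E l v = 0 -> v != 0 ->
  l * rd v v < rd (c v) v.

Let E_comm l m x : E l (E m x) = E m (E l x).
Proof. exact: bicommutant_comm (proj_mem (EP l)) (proj_mem (EP m)). Qed.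

Let E_lin l : linear (E l).
Proof. by case: (EP l) => _ [[]]. Qed.

(** On a vector of the range of [E l] that [E m] kills, the form of [c] would be
    at most [l] and greater than [m]. *)
Lemma family_nested l m x : l <= m -> E m (E l x) = E l x.
Proof.
move=> lm; apply/eqP; rewrite eq_sym -subr_eq0; apply/negPn/negP => u0.
have Emu : E m (E l x - E m (E l x)) = 0.
  by rewrite (opB (E_lin m)) (proj_idem (EP m)) subrr.
have Elu : E l (E l x - E m (E l x)) = E l x - E m (E l x).
  by rewrite (opB (E_lin l)) E_comm (proj_idem (EP l)).
have := E_le Elu; have := E_gt Emu u0.
set u := _ - _ => h1 h2; have := rdot_ge0 dot u; nra.
Qed.

Lemma family_nested_r l m x : l <= m -> E l (E m x) = E l x.
Proof. by move=> lm; rewrite E_comm family_nested. Qed.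

Lemma family_mono x : nondecreasing (fun l => rd (E l x) x).
Proof.
move=> l m lm /=; rewrite -(proj_rdot x (EP m)).
have := eff_le1 (proj_eff (EP l)) (E m x).
rewrite family_nested_r //.
have [[_ sl _] _] := proj_eff (EP m).
by rewrite -sl family_nested.
Qed.

(** On the range of the limit [p] of these decreasing projections, the form of
    [c] is at most [l]; hence that range lies in the range of [E l]. *)
Lemma family_right_limit x l :
  (fun n => E (l + n.+1%:R^-1) x) @ \oo --> E l x.
Proof.
pose e n := (n.+1%:R^-1 : R).
have e0 n : 0 < e n by rewrite invr_gt0 ltr0n.
have e_le (n m : nat) : (n <= m)%N -> e m <= e n.
  by move=> nm; rewrite lef_pV2 ?posrE ?ltr0n // ler_nat.
pose u n := idfun - E (l + e n).
have eu n : effect dot (u n) := effect_compl (proj_eff (EP _)).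
have mono n y : rd (u n y) y <= rd (u n.+1 y) y.
  rewrite /u !op_subE !rdotDl !rdotNl lerD2l lerN2; apply: family_mono.
  by rewrite lerD2l e_le.
have [q uq] := monotone_limit Hdot eu mono.
have up y : (fun n => E (l + e n) y) @ \oo --> (idfun - q) y.
  rewrite (_ : (fun n => _) = (fun n => y - u n y)).
    by apply: cvgB; [exact: cvg_cst|exact: uq].
  by apply/funext => n; rewrite /u op_subE /= subKr.
set p := idfun - q in up.
have stable n y : E (l + e n) (p y) = p y.
  have h1 := cvg_linear (proj2 (proj1 (proj_mem (EP (l + e n))))) (up y).
  have h2 : (fun m => E (l + e n) (E (l + e m) y)) @ \oo --> p y.
    apply: cvg_trans (up y); apply: near_eq_cvg; exists n => // m /= nm.
    by rewrite family_nested // lerD2l e_le.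
  exact: norm_cvg_unique h1 h2.
have pE y : p y = E l (p y).
  apply/eqP; rewrite -subr_eq0; apply/negPn/negP => u0.
  have Elu : E l (p y - E l (p y)) = 0.
    by rewrite (opB (E_lin l)) (proj_idem (EP l)) subrr.
  have Enu n : E (l + e n) (p y - E l (p y)) = p y - E l (p y).
    by rewrite (opB (E_lin _)) stable family_nested // lerDl ltW.
  have h n := E_le (Enu n); have := E_gt Elu u0; move: h.
  set w := _ - _ => h h'.
  have w0 : 0 < rd w w by rewrite lt_def rdot_ge0 andbT;
    apply: contra_neq u0 => /rdot_eq0.
  have : 0 < (rd (c w) w - l * rd w w) / rd w w by rewrite divr_gt0 // subr_gt0.
  set d := (_ / _) => d0.
  have := h (Num.trunc d^-1); apply/negP; rewrite -ltNge mulrDl addrC -ltrBrDr.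
  rewrite -ltr_pdivlMr // -/d /e invf_plt ?posrE ?ltr0n //.
  exact: truncnS_gt.
have -> : E l x = p x; last exact: up.
rewrite pE.
have h1 := cvg_linear (proj2 (proj1 (proj_mem (EP l)))) (up x).
have h2 : (fun n => E l (E (l + e n) x)) @ \oo --> E l x.
  rewrite (_ : (fun n => _) = (fun=> E l x)); first exact: cvg_cst.
  by apply/funext => n; rewrite family_nested_r // lerDl ltW.
exact: norm_cvg_unique h2 h1.
Qed.

Lemma family_right_continuous x l :
  (fun l => rd (E l x) x : R) @ at_right l --> (rd (E l x) x : R).
Proof.
apply/cvgrPdist_lt => e e0.
have := cvg_rdotl Hdot (y := x) (@family_right_limit x l).
move=> /cvgrPdist_lt/(_ e e0)[N _ hN].
have hN1 := hN N (leqnn N); near=> m.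
have lm : l < m by [].
have mN : m <= l + N.+1%:R^-1.
  by near: m; apply: nbhs_right_le; rewrite ltrDl invr_gt0 ltr0n.
move: hN1 => /=; have h1 := family_mono x (ltW lm).
have h2 := family_mono x mN.
by rewrite !ltr_norml => /andP[h3 h4]; apply/andP; split; lra.
Unshelve. all: by end_near.
Qed.

Lemma family_bounds : exists2 L : R, 0 <= L &
  (forall l v, l < - L -> E l v = 0) /\ (forall l v, L <= l -> E l v = v).
Proof.
have [K K0 cK] := bounded_form_bound Hdot bc; exists K => //.
split=> l v hl.
  have h := E_le (proj_idem (EP l) v); move: (cK (E l v)).
  rewrite ler_norml => /andP[h1 h2]; apply: (@rdot_eq0 _ _ dot).
  have := rdot_ge0 dot (E l v); nra.
apply/eqP; rewrite eq_sym -subr_eq0; apply/negPn/negP => u0.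
have Eu : E l (v - E l v) = 0.
  by rewrite (opB (E_lin l)) (proj_idem (EP l)) subrr.
have := E_gt Eu u0; have := cK (v - E l v); set u := _ - _.
rewrite ler_norml => /andP[h1 h2]; have := rdot_ge0 dot u; nra.
Qed.

End family.
End SpectralFamily.

(** * Stieltjes measures *)

Section Stieltjes.
Context {R : realType}.
Implicit Types (f F G : R -> R) (mu :
  {measure set (measurableTypeR R) -> \bar R}).

(** The two conditions outside [[a, b]] make the total mass finite. *)
Lemma exists_stieltjes f (a b T : R) : nondecreasing f ->
  (forall x, f%function @ at_right x --> f%function x) ->
  (forall x, x < a -> f x = 0) -> (forall x, b <= x -> f x = T) ->
  exists mu : {measure set (measurableTypeR R) -> \bar R},
    (forall s t, s <= t -> mu [set` `]s, t]] = (f t - f s)%:E) /\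
    mu setT = T%:E.
Proof.
move=> fnd frc fa fb.
pose g : cumulative R R := HB.pack f (isCumulative.Build R _ R f fnd frc).
have muE s t : s <= t ->
    lebesgue_stieltjes_measure g [set` `]s, t]] = (f t - f s)%:E.
  move=> st; rewrite /lebesgue_stieltjes_measure /measure_extension.
  by rewrite measurable_mu_extE/=; [rewrite wlength_itv_bnd|exact: is_ocitv].
exists (lebesgue_stieltjes_measure g); split => //.
rewrite -(bigcup_itvT false false).
pose I n : set (measurableTypeR R) := [set` `]- (n%:R), n%:R]].
have h1 : (lebesgue_stieltjes_measure g \o I) @ \oo -->
    lebesgue_stieltjes_measure g (\bigcup_n I n).
  apply: nondecreasing_cvg_mu; rewrite /I//.
  - by apply: bigcup_measurable => i _; exact: measurable_itv.
  - by move=> *; apply/subsetPset/subset_itv; rewrite leBSide/= ?lerN2 ler_nat.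
have h2 : (lebesgue_stieltjes_measure g \o I) @ \oo --> T%:E.
  apply: cvg_near_cst; exists (Num.trunc (`|a| + `|b|)).+1 => // n /= Nn.
  have nab : `|a| + `|b| < n%:R.
    by apply: lt_le_trans (truncnS_gt _) _; rewrite ler_nat.
  have n0 : - n%:R <= n%:R :> R by rewrite ge0_cp.
  rewrite [LHS](muE _ _ n0); congr EFin.
  have := ler_norm b; have := ler_norm (- a); rewrite normrN.
  have := normr_ge0 a; have := normr_ge0 b => b0 a0 a1 b1.
  by rewrite (fa (- n%:R)) ?(fb n%:R) ?subr0 //; lra.
have h3 : lebesgue_stieltjes_measure g (\bigcup_n I n) = T%:E.
  exact: cvg_unique h1 h2.
exact: h3.
Qed.

(** The integral of the identity is determined by Riemann sums: any interval
    function squeezed between the lower and upper sums computes it. *)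
Lemma stieltjes_integral_id mu (F G : R -> R) (L T : R) : 0 <= L ->
  (forall s t, s <= t -> mu [set` `]s, t]] = (F t - F s)%:E) ->
  mu setT = T%:E -> F L = T -> F (- L) = 0 ->
  (forall s t, s <= t -> s * (F t - F s) <= G t - G s <= t * (F t - F s)) ->
  mu.-integrable setT (fun l => (l : R)%:E) /\
  (\int[mu]_l (l : R)%:E = (G L - G (- L))%:E)%E.
Proof.
move=> L0 muE muT FL FNL FG.
have LL : - L <= L by lra.
have int_itv s t : mu.-integrable [set` `]s, t]] (EFin \o (fun l : R => l)).
  apply: measurable_bounded_integrable; first exact: measurable_itv.
  - have [st|ts] := leP s t; first by rewrite muE // ltry.
    by rewrite set_itv_ge ?measure0 // bnd_simp -leNgt ltW.
  - exact: measurable_id.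
  - exists (`|s| + `|t|); split; first by rewrite num_real.
    move=> M hM l /=; rewrite in_itv /= => /andP[sl lt].
    apply: ltW; apply: le_lt_trans hM; rewrite ler_norml.
    have := ler_norm t; have := ler_norm (- s); rewrite normrN.
    by have := normr_ge0 s; have := normr_ge0 t; lra.
pose I t := \int[mu]_(l in [set` `]- L, t]]) (l : R).
have Idiff s t : - L <= s -> s <= t ->
    I t - I s = \int[mu]_(l in [set` `]s, t]]) (l : R).
  move=> Ls st; have E : [set` `]- L, t]] = [set` `]- L, s]] `|` [set` `]s, t]].
    by apply: itv_bndbnd_setU; rewrite bnd_simp.
  rewrite /I E Rintegral_setU //; first by rewrite addrAC subrr add0r.
  - by rewrite -E; exact: int_itv.
  - apply/disj_setPS => l /= [].
    by rewrite !in_itv /= => /andP[_ ls] /andP[/lt_le_trans/(_ ls)];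
      rewrite ltxx.
have Fmono s t : s <= t -> 0 <= F t - F s.
  by move=> st; rewrite -lee_fin -muE.
have Ibd s t : - L <= s -> s <= t ->
    s * (F t - F s) <= I t - I s <= t * (F t - F s).
  move=> Ls st; rewrite Idiff //.
  have cst (r : R) : \int[mu]_(l in [set` `]s, t]]) r = r * (F t - F s).
    by rewrite Rintegral_cst ?muE //; exact: measurable_itv.
  have icst (r : R) : mu.-integrable [set` `]s, t]] (EFin \o (fun=> r)).
    apply: measurable_bounded_integrable => //; first by rewrite muE // ltry.
    exists `|r|; split; first by rewrite num_real.
    by move=> M hM l _ /=; exact: ltW.
  rewrite -!cst; apply/andP; split; apply: le_Rintegral => //.
  - by move=> l /=; rewrite in_itv /= => /andP[/ltW].
  - by move=> l /=; rewrite in_itv /= => /andP[].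
have hIG : I L - G L = I (- L) - G (- L).
  apply: (@second_order_const _ (fun l => I l - G l) F) => // s t Ls st tL.
  have := Ibd s t Ls st; have := FG s t st; have := Fmono s t st.
  move=> h0 /andP[h1 h2] /andP[h3 h4]; rewrite ler_norml; apply/andP; nra.
have I0 : I (- L) = 0.
  by rewrite /I set_itv_ge ?Rintegral_set0 // bnd_simp ltxx.
have IL : I L = G L - G (- L) by lra.
pose D : set (measurableTypeR R) := [set` `]- L, L]].
have mD : measurable D by exact: measurable_itv.
have muD : mu D = T%:E by rewrite muE // FL FNL subr0.
have muC : mu (~` D) = 0.
  have muTfin : (mu setT < +oo)%E by rewrite muT ltry.
  have h : mu (setT `\` D) = (mu setT - mu (setT `&` D))%E.
    by apply: measureD => //; exact: (@measurableT _ (measurableTypeR R)).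
  by rewrite -setTD h setTI muT muD -EFinB subrr.
have TD : setT `\` (~` D) = D by rewrite setTD setCK.
have iT : mu.-integrable setT (fun l : R => l%:E).
  apply/(negligible_integrable (N := ~` D)) => //.
  - exact: measurableC.
  - exact: EFin_measurable.
  - by rewrite TD; exact: int_itv.
split=> //; rewrite (@negligible_integral _ _ _ mu setT (~` D)) //.
- rewrite TD -IL /I /Rintegral fineK //.
  exact: integrable_fin_num (int_itv _ _).
- exact: measurableC.
Qed.

End Stieltjes.

(** * Existence of the spectral measure *)

Section SpectralMeasure.
Local Open Scope complex_scope.
Context {R : realType} {H : completeNormedModType R[i]}.
Variable dot : {dot H for @Num.conj R[i]}.
Hypothesis Hdot : norm_from_dot dot.
Implicit Types (a b : H -> H) (x y z v : H) (l : R).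

Local Notation rd := (rdot dot).

Section projections.
Variable c : H -> H.
Hypothesis (bc : bounded_op c).
Local Notation A := (bicommutant c).

Lemma proj_of_id : proj_of dot A idfun.
Proof. by split => //; [exact: bicommutant_id|exact: id_effect]. Qed.

Lemma proj_of_compl p : proj_of dot A p -> proj_of dot A (idfun - p).
Proof.
move=> [Ap ep pp]; split; last first.
- move=> x; rewrite !op_subE /= (opB (pos_lin ep)) pp subrr subr0 //.
- exact: effect_compl.
- by apply: bicommutant_sub => //; exact: bicommutant_id.
Qed.

Lemma proj_of_0 : proj_of dot A 0.
Proof. by rewrite -(subrr idfun); exact: proj_of_compl proj_of_id. Qed.

Lemma proj_of_sub p q : proj_of dot A p -> proj_of dot A q ->
  (forall x, p (q x) = q x) -> proj_of dot A (p - q).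
Proof.
move=> [Ap ep pp] [Aq eq_ qq] pq.
have qp x : q (p x) = q x by rewrite (bicommutant_comm bc x Aq Ap).
split; first exact: bicommutant_sub.
- apply: effect_sub => // x.
  have := eff_le1 eq_ (p x).
  have [[lp sp _] _] := ep; have [[lq sq _] _] := eq_.
  by rewrite qp -(sp (q x) x) pq -(sp (p x) x) pp.
move=> x; rewrite !op_subE (opB (pos_lin ep)) (opB (pos_lin eq_)).
by rewrite pp pq qp qq subrr subr0.
Qed.

Lemma proj_of_add p q : proj_of dot A p -> proj_of dot A q ->
  (forall y, rd (p y) y + rd (q y) y <= rd y y) -> proj_of dot A (p + q).
Proof.
move=> hp hq pq; have [Ap ep pp] := hp; have [Aq eq_ qq] := hq.
have qp x : q (p x) = 0 := proj_orth x hp hq pq.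
have pq0 x : p (q x) = 0 by rewrite (bicommutant_comm bc x Ap Aq) qp.
split; first exact: bicommutant_add.
- split; first exact: positive_add (eff_pos ep) (eff_pos eq_).
  by move=> x; rewrite op_addE rdotDl.
move=> x; rewrite !op_addE (opD (pos_lin ep)) (opD (pos_lin eq_)).
by rewrite pp pq0 qp qq addr0 add0r.
Qed.

Lemma proj_of_limit (u : nat -> H -> H) a : (forall n, proj_of dot A (u n)) ->
  (forall x, (fun n => u n x) @ \oo --> a x) -> proj_of dot A a.
Proof.
move=> pu ua; have ea : effect dot a.
  by apply: (limit_effect Hdot ua) => n; exact: proj_eff (pu n).
split=> //.
  by apply: (bicommutant_limit Hdot ea ua) => n; exact: proj_mem (pu n).
move=> x; have h1 : (fun n => u n (u n x)) @ \oo --> a (a x).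
  by apply: (square_limit Hdot _ ua) => n; exact: proj_eff (pu n).
rewrite (_ : (fun n => _) = (fun n => u n x)) in h1.
  exact: norm_cvg_unique h1 (ua x).
by apply/funext => n; exact: (proj_idem (pu n)).
Qed.

End projections.

Variable c : H -> H.
Hypothesis (bc : bounded_op c) (sc : symmetric_op dot c).
Local Notation A := (bicommutant c).

Let measures (mu : H -> {measure set (measurableTypeR R) -> \bar R})
    (S : set (measurableTypeR R)) :=
  exists p, proj_of dot A p /\ forall x, mu x S = (rd (p x) x)%:E.

(** The Borel sets whose scalar masses come from a projection form a Dynkin
    system: countable disjoint unions are handled by strong limits of the
    increasing partial sums, which are projections again. *)
Lemma borel_projections (mu :
  H -> {measure set (measurableTypeR R) -> \bar R}) :
  (forall x, mu x setT = (rd x x)%:E) ->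
  (forall s t : R, s <= t -> measures mu [set` `]s, t]]) ->
  forall S : set (measurableTypeR R), measurable S -> measures mu S.
Proof.
move=> muT muI.
pose G : set (set (measurableTypeR R)) := [set S | ocitv S].
apply: (@dynkin_induction _ (measurableTypeR R) G (measures mu)) => //.
- exact: ocitvI.
- by exists idfun; split=> //; exact: proj_of_id.
- move=> _ [[s t] _ <-] /=.
  have [st|ts] := leP s t; first exact: muI.
  exists 0; split; first exact: proj_of_0.
  by move=> x; rewrite set_itv_ge ?bnd_simp -?leNgt ?ltW // measure0 rdot0l.
- move=> S mS [p [hp pE]]; exists (idfun - p).
  split; first exact: proj_of_compl.
  move=> x; have fin : (mu x setT < +oo)%E by rewrite muT ltry.
  have h : mu x (setT `\` S) = (mu x setT - mu x (setT `&` S))%E.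
    by apply: measureD => //; exact: (@measurableT _ (measurableTypeR R)).
  by rewrite -setTD h setTI muT pE -EFinB op_subE rdotDl rdotNl.
move=> F mF tF PF.
pose U n : set (measurableTypeR R) := \big[setU/set0]_(i < n) F i.
have mU n : measurable (U n) by apply: bigsetU_measurable.
have le1 x S : measurable S -> (mu x S <= (rd x x)%:E)%E.
  by move=> mS; rewrite -muT; apply: le_measure => //; rewrite inE.
have PU n : measures mu (U n).
  elim: n => [|n [p [hp pE]]].
    exists 0; split; first exact: proj_of_0.
    by move=> x; rewrite /U big_ord0 measure0 rdot0l.
  have [q [hq qE]] := PF n.
  have disj : U n `&` F n = set0.
    rewrite -subset0 => l []; rewrite /U -bigcup_mkord => -[i /= ni Fil] Fnl.
    have ein : i = n by apply: tF => //; exists l.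
    by rewrite ein ltnn in ni.
  have addE x : mu x (U n.+1) = (rd (p x) x + rd (q x) x)%:E.
    have h : mu x (U n `|` F n) = (mu x (U n) + mu x (F n))%E.
      by apply: measureU.
    by rewrite /U big_ord_recr /= -/(U n) h pE qE.
  exists (p + q); split; last by move=> x; rewrite addE op_addE rdotDl.
  apply: proj_of_add => // y.
  by rewrite -lee_fin -addE; exact: le1.
have [u hu] := choice PU.
have mono n x : rd (u n x) x <= rd (u n.+1 x) x.
  rewrite -lee_fin -(proj2 (hu n)) -(proj2 (hu n.+1)).
  apply: le_measure; rewrite ?inE // /U big_ord_recr /=; exact: subsetUl.
have [a ua] := monotone_limit Hdot (fun n => proj_eff (proj1 (hu n))) mono.
exists a; split; first exact: proj_of_limit (fun n => proj1 (hu n)) ua.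
move=> x.
have h1 : (mu x \o U) @ \oo --> mu x (\bigcup_n U n).
  apply: nondecreasing_cvg_mu => //.
    by apply: bigcup_measurable => i _; exact: mU.
  by move=> m n mn; apply/subsetPset; exact: subset_bigsetU.
have UE : \bigcup_n U n = \bigcup_k F k.
  rewrite -(bigcup_bigsetU_bigcup F); apply/seteqP;
    split=> [l [[|n] _ ln]|l [n _ ln]].
  - by move: ln; rewrite /U big_ord0.
  - by exists n.
  - by exists n.+1.
rewrite UE in h1.
have h2 : (mu x \o U) @ \oo --> (rd (a x) x)%:E.
  rewrite (_ : _ \o _ = (fun n => (rd (u n x) x)%:E)).
    by apply: cvg_EFin; [exact: nearW|exact: cvg_rdotl (ua x)].
  by apply/funext => n /=; rewrite (proj2 (hu n)).
exact: cvg_unique h1 h2.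
Qed.

(** The projections [E l] of [exists_spectral_cut] give the masses of half-open
    intervals, [borel_projections] those of Borel sets, and the Riemann sums of
    [l] against [E] squeeze the form of [c]. *)
Theorem exists_spectral_measure :
  exists (P : set (measurableTypeR R) -> H -> H)
         (mu : H -> {measure set (measurableTypeR R) -> \bar R}),
  [/\ forall S, measurable S -> proj_of dot A (P S) /\
        forall x, mu x S = (rd (P S x) x)%:E,
      P setT = idfun
    & forall x, (mu x).-integrable setT (fun l => (l : R)%:E) /\
        (\int[mu x]_l (l : R)%:E = (rd (c x) x)%:E)%E].
Proof.
have [E0 hE] := choice (exists_spectral_cut Hdot bc sc).
have [E EE] : exists E, E = E0 by exists E0.
rewrite -EE in hE.
have EP l : proj_of dot A (E l) by case: (hE l).
have Ele l v : E l v = v ->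
  rd (c v) v <= l * rd v v by case: (hE l) => ? ? ? + _; apply.
have Egt l v : E l v = 0 -> v != 0 -> l * rd v v < rd (c v) v.
  by case: (hE l) => ? ? ? _; apply.
have [L L0 [Elow Ehigh]] := family_bounds Hdot bc EP Ele Egt.
have hmu x : exists mu : {measure set (measurableTypeR R) -> \bar R},
    (forall s t, s <= t -> mu [set` `]s, t]] =
       (rd (E t x) x - rd (E s x) x)%:E) /\ mu setT = (rd x x)%:E.
  apply: (@exists_stieltjes _ (fun l => rd (E l x) x) (- L) L).
  - exact: family_mono EP Ele Egt x.
  - move=> l; exact: (@family_right_continuous _ _ _ Hdot _ bc _ EP Ele Egt x
      l).
  - by move=> l lL; rewrite Elow // rdot0l.
  - by move=> l lL; rewrite Ehigh.
have [mu muE] := choice hmu.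
have diff s t : s <= t -> proj_of dot A (E t - E s).
  by move=> st; apply: proj_of_sub => // x;
    exact: family_nested EP Ele Egt _ _ x st.
have mS : forall S : set (measurableTypeR R), exists p,
    measurable S -> proj_of dot A p /\ forall x, mu x S = (rd (p x) x)%:E.
  move=> S; have [h|h] := pselect (measurable S); last by exists 0.
  have [] // := @borel_projections mu _ _ S h; last by move=> p hp; exists p.
    by move=> x; exact: (proj2 (muE x)).
  move=> s t st; exists (E t - E s); split; first exact: diff.
  by move=> x; rewrite (proj1 (muE x)) // op_subE rdotDl rdotNl.
have [P hP] := choice mS.
exists P, mu; split=> //.
  have [hT muT] := hP setT (@measurableT _ (measurableTypeR R)).
  apply/funext => x; apply/esym/eqP; rewrite -subr_eq0; apply/eqP.
  have hc := proj_of_compl hT.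
  apply: (@rdot_eq0 _ _ dot); rewrite -[_ - _]/((idfun - P setT) x).
  rewrite (proj_rdot x hc) op_subE rdotDl rdotNl /=.
  have : (rd x x)%:E = (rd (P setT x) x)%:E by rewrite -muT (proj2 (muE x)).
  by move=> [->]; rewrite subrr.
move=> x.
have [bl lE] : (mu x).-integrable setT (fun l => (l : R)%:E) /\
    (\int[mu x]_l (l : R)%:E = (rd (c (E (L + 1) x)) x -
       rd (c (E (- (L + 1)) x)) x)%:E)%E.
  apply: (@stieltjes_integral_id _ (mu x) (fun l => rd (E l x) x)
    (fun l => rd (c (E l x)) x) (L + 1) (rd x x)).
  - by lra.
  - exact: (proj1 (muE x)).
  - exact: (proj2 (muE x)).
  - by rewrite Ehigh //; lra.
  - by rewrite Elow ?rdot0l //; lra.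
  move=> s t st; have hp := diff s t st.
  have [Ap ep pp] := hp.
  have cp y : c ((E t - E s) y) = (E t - E s) (c y).
    exact: (bicommutant_comm bc y (bicommutant_gen bc) Ap).
  have -> : rd (c (E t x)) x - rd (c (E s x)) x =
      rd (c ((E t - E s) x)) ((E t - E s) x).
    rewrite cp -(pos_sym ep) pp -cp op_subE (opB (proj1 bc)) rdotDl rdotNl //.
  have -> : rd (E t x) x - rd (E s x) x = rd ((E t - E s) x) ((E t - E s) x).
    by rewrite (proj_rdot x hp) op_subE rdotDl rdotNl.
  have nest := family_nested bc EP Ele Egt.
  have Etp : E t ((E t - E s) x) = (E t - E s) x.
    rewrite op_subE (opB (pos_lin (proj_eff (EP t)))) (proj_idem (EP t)).
    by rewrite (nest _ _ x st).
  have Esp : E s ((E t - E s) x) = 0.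
    rewrite op_subE (opB (pos_lin (proj_eff (EP s)))) (proj_idem (EP s)).
    by rewrite (family_nested_r bc EP Ele Egt x st) subrr.
  rewrite (Ele _ _ Etp) andbT.
  have [->|p0] := eqVneq ((E t - E s) x) 0.
    by rewrite rdot0l rdot0r mulr0.
  exact: ltW (Egt _ _ Esp p0).
split=> //; rewrite lE Ehigh; last by lra.
by rewrite Elow ?(op0 (proj1 bc)) ?rdot0l ?subr0 //; lra.
Qed.

End SpectralMeasure.

(** * Spectral measures in a corner *)

Section Corner.
Local Open Scope complex_scope.
Context {R : realType} {H : completeNormedModType R[i]}.
Variable dot : {dot H for @Num.conj R[i]}.
Hypothesis Hdot : norm_from_dot dot.
Implicit Types (a b : H -> H) (x y z v : H).

Local Notation rd := (rdot dot).

Variable M : set (H -> H).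
Hypothesis HM : von_neumann_algebra dot M.

Lemma vn_bounded : M `<=` bounded_op. Proof. by case: HM. Qed.

Lemma vn_bicommutant c : M c -> bicommutant c `<=` M.
Proof.
case: HM => bM _ <- Mc a [ba Aa]; split=> // b [bb Mb]; apply: Aa.
by split=> // _ ->; apply: Mb; case: HM Mc => _ _ ->.
Qed.

Lemma vn_id : M idfun.
Proof. by case: HM => _ _ <-; exact: commutant_id. Qed.

Let bC : commutant M `<=` (@bounded_op R H) := @commutant_bounded _ _ _.

Lemma vn_add a b : M a -> M b -> M (a + b).
Proof. by case: HM => _ _ <-; exact: commutant_add. Qed.

Lemma vn_scale k a : M a -> M (k *: a).
Proof. by case: HM => _ _ <-; exact: commutant_scale. Qed.

Lemma vn_sub a b : M a -> M b -> M (a - b).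
Proof. by case: HM => _ _ <-; exact: commutant_sub. Qed.

Lemma vn_comp a b : M a -> M b -> M (a \o b).
Proof. by case: HM => _ _ <-; exact: commutant_comp. Qed.

Lemma vn_0 : M 0.
Proof. by rewrite -(subrr idfun); apply: vn_sub; exact: vn_id. Qed.

Lemma vn_sum (I : finType) (F : I -> H -> H) : (forall i, M (F i)) ->
  M (\sum_i F i).
Proof. by move=> MF; elim/big_ind: _ => //; [exact: vn_0|exact: vn_add]. Qed.

Lemma vn_linear a : M a -> linear a.
Proof. by move=> /vn_bounded[]. Qed.

(** The spectral projections of [c] on the whole space commute with [r];
    multiplied by [r], they have total mass [r]. *)
Lemma exists_corner_spectral_measure r c : projection_in dot M r -> M c ->
  selfadjoint dot c -> r \o c = c -> c \o r = c ->
  exists E, spectral_measure dot (corner M r) r c E.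
Proof.
move=> [Mr sr rr] Mc sc rc cr.
have bc := vn_bounded Mc.
have [P [mu [hP PT hmu]]] :=
  exists_spectral_measure Hdot bc (selfadjoint_symmetric sc).
have comm S x : measurable S -> r (P S x) = P S (r x).
  move=> mS; have [[_ AP] _ _] := (hP S mS).1.
  apply/esym; have h : commutant [set c] r.
    by split; [exact: vn_bounded|move=> _ ->; rewrite rc cr].
  exact: (congr1 (@^~ x) (AP _ h)).
have rrE x : r (r x) = r x := congr1 (@^~ x) rr.
have sr' := selfadjoint_symmetric sr.
exists (fun S => r \o P S \o r); split.
- move=> S mS; have [AP eP PP] := (hP S mS).1; split.
  + by exists (P S) => //; exact: vn_bicommutant AP.
  + apply: symmetric_selfadjoint.
      by move=> k x y; rewrite /= (vn_linear Mr) (pos_lin eP) (vn_linear Mr).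
    by move=> x y /=; rewrite sr' (pos_sym eP) sr'.
  + by apply/funext => x /=; rewrite rrE -(comm S (P S _)) // PP rrE.
- by rewrite PT; apply/funext => x /=; rewrite rrE.
move=> x; exists (mu (r x)); split.
- move=> S mS; rewrite (hP S mS).2 /=; congr EFin.
  by rewrite -/(rd (r (P S (r x))) x) sr'.
- exact: (hmu (r x)).1.
rewrite (hmu (r x)).2; congr EFin.
have cE y : c (r y) = c y := congr1 (@^~ y) cr.
have rE y : r (c y) = c y := congr1 (@^~ y) rc.
by rewrite cE -/(rd (c x) x) -[in RHS]rE sr'.
Qed.

End Corner.

Section SpectralMeasureProps.
Local Open Scope complex_scope.
Context {R : realType} {H : completeNormedModType R[i]}.
Variable dot : {dot H for @Num.conj R[i]}.
Hypothesis Hdot : norm_from_dot dot.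
Implicit Types (a b : H -> H) (x y z v : H).

Local Notation rd := (rdot dot).

Variables (N : set (H -> H)) (e c : H -> H).
Variable E : set (measurableTypeR R) -> H -> H.
Hypothesis hE : spectral_measure dot N e c E.
Hypothesis bN : N `<=` bounded_op.
Hypotheses (lc : linear c) (sc : symmetric_op dot c).
Hypotheses (ce : forall x, c (e x) = c x) (ec : forall x, e (c x) = c x).
Implicit Types (S T : set (measurableTypeR R)).

Lemma smeasure_proj S : measurable S -> proj_of dot N (E S).
Proof.
case: hE => h _ _ /h[NE sE EE]; have [lE _] := bN NE.
have {}sE := selfadjoint_symmetric sE.
have {}EE x : E S (E S x) = E S x := congr1 (@^~ x) EE.
split=> //; split; first split => // x.
  by rewrite -EE sE rdot_ge0.
move=> x; have := rdot_ge0 dot (x - E S x).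
have h1 : rd (E S x) (E S x) = rd (E S x) x by rewrite -(sE (E S x)) EE.
rewrite !rdotE h1 (rdotC _ x (E S x)); lra.
Qed.

Lemma smeasure_measure x : exists mu :
  {measure set (measurableTypeR R) -> \bar R},
  [/\ forall S, measurable S -> mu S = (rd (E S x) x)%:E,
      mu.-integrable setT (fun l => (l : R)%:E)
    & (\int[mu]_l (l : R)%:E = (rd (c x) x)%:E)%E].
Proof. by case: hE => _ _; apply. Qed.

Lemma quadratic_ext a b : linear a -> linear b ->
  symmetric_op dot a -> symmetric_op dot b ->
  (forall x, rd (a x) x = rd (b x) x) -> forall x, a x = b x.
Proof.
move=> la lb sa sb ab x; apply/eqP; rewrite -subr_eq0; apply/eqP.
apply: (@pos_ker _ _ dot (a - b)).
- by move=> k y z; rewrite !op_subE la lb scalerBr opprD addrACA.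
- by move=> y z; rewrite !op_subE !rdotE sa sb.
- by move=> y; rewrite op_subE rdotDl rdotNl ab subrr.
- by rewrite op_subE rdotDl rdotNl ab subrr.
Qed.

(** The scalar measures are additive, and a symmetric operator is determined by
    its quadratic form.  With [proj_orth], additivity implies that [E] is
    multiplicative. *)
Lemma smeasure_add S T x : measurable S -> measurable T -> S `&` T = set0 ->
  E (S `|` T) x = E S x + E T x.
Proof.
move=> mS mT ST; have [_ [[lST sST _] _] _] :=
  smeasure_proj (measurableU _ _ mS mT).
have [_ [pS _] _] := smeasure_proj mS; have [_ [pT _] _] := smeasure_proj mT.
have [l s _] := positive_add pS pT.
apply: (@quadratic_ext (E (S `|` T)) (E S + E T)) => // y.
have [mu [muE _ _]] := smeasure_measure y.
have : mu (S `|` T) = (mu S + mu T)%E by apply: measureU.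
rewrite !muE //; last exact: measurableU.
by move=> [->]; rewrite op_addE rdotDl.
Qed.

Lemma smeasure_orth S T x : measurable S -> measurable T -> S `&` T = set0 ->
  E T (E S x) = 0.
Proof.
move=> mS mT ST; apply: (proj_orth _ (smeasure_proj mS) (smeasure_proj mT)) =>
  y.
rewrite -rdotDl -smeasure_add //.
exact: eff_le1 (proj_eff (smeasure_proj (measurableU _ _ mS mT))) y.
Qed.

Lemma smeasure_sub S T x : measurable S -> measurable T -> S `<=` T ->
  E T (E S x) = E S x.
Proof.
move=> mS mT ST; have mD := measurableD mT mS.
have -> : T = S `|` (T `\` S) by rewrite setUIr setUCr setIT;
  apply/esym/setUidPr.
have disj : S `&` (T `\` S) = set0 by rewrite setDIK.
by rewrite smeasure_add // (smeasure_orth x mS mD disj) (proj_idem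
  (smeasure_proj mS)) addr0.
Qed.

Lemma smeasure_comm S T x : measurable S -> measurable T ->
  E T (E S x) = E S (E T x).
Proof.
move=> mS mT.
have key U V y : measurable U -> measurable V ->
    E V (E U y) = E (U `&` V) y.
  move=> mU mV; have mI := measurableI _ _ mU mV.
  have mD := measurableD mU mV.
  have UE : U = (U `&` V) `|` (U `\` V) by rewrite setDE -setIUr setUCr setIT.
  rewrite [in LHS]UE smeasure_add //;
    last by rewrite -subset0 => z [[_ Vz] [_ /(_ Vz)]].
  have [_ [[lV _ _] _] _] := smeasure_proj mV.
  rewrite (opD lV) (smeasure_orth _ mD mV) ?addr0;
    last by rewrite -subset0 => z [[_ nVz] /nVz].
  exact: smeasure_sub.
by rewrite key // key // setIC.
Qed.

(** As no [E T] mixes [x] and [y], the scalar measure of [x + y] is the sum of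
    those of [x] and [y].  Integrating the identity shows that the form of [c]
    has no cross term. *)
Lemma smeasure_cross S x y : measurable S -> E S x = x -> E (~` S) y = y ->
  rd (c x) y = 0.
Proof.
move=> mS Sx Sy; have mC := measurableC mS.
have [mx [mxE ix Ix]] := smeasure_measure x;
  have [my [myE iy Iy]] := smeasure_measure y.
have [mz [mzE iz Iz]] := smeasure_measure (x + y).
have cross T : measurable T -> rd (E T x) y = 0.
  move=> mT; rewrite -Sx smeasure_comm //.
  have [_ [[_ sS _] _] _] := smeasure_proj mS.
  by rewrite sS -Sy smeasure_orth ?rdot0r // setICl.
have mzA T : measurable T -> mz T = (measure_add mx my) T.
  move=> mT; rewrite mzE // [RHS]measure_addE mxE // myE //.
  have [_ [[lT sT _] _] _] := smeasure_proj mT.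
  have h := cross T mT.
  rewrite (opD lT) !rdotE h (sT y x) (rdotC _ y) h EFinD.
  by rewrite addr0 add0r.
have : (\int[mz]_l (l : R)%:E =
    \int[mx]_l (l : R)%:E + \int[my]_l (l : R)%:E)%E.
  rewrite -integral_measure_add //.
    by apply: eq_measure_integral => T mT _; exact: mzA.
rewrite Ix Iy Iz => -[]; rewrite (opD lc) !rdotE (sc y x) (rdotC _ y (c x));
  lra.
Qed.

Lemma smeasure_commute S x : measurable S -> c (E S x) = E S (c x).
Proof.
move=> mS; have mC := measurableC mS.
have [_ ET _] := hE.
have eE z : e z = E S z + E (~` S) z.
  by rewrite -smeasure_add ?setICr // setUCr ET.
have [_ [[lS sS _] _] SS] := smeasure_proj mS.
have [_ [[_ sC _] _] CC] := smeasure_proj mC.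
have [_ [[_ sT _] _] _] := smeasure_proj (@measurableT _ (measurableTypeR R)).
rewrite ET in sT.
have part z w : rd (c (E S z)) w = rd (c (E S z)) (E S w).
  by rewrite -[in LHS]ec sT eE rdotDr (smeasure_cross mS (SS z) (CC w)) addr0.
apply: (rdot_ext (dot := dot)) => w.
by rewrite part (sS (c x) w) (sc x) (rdotC _ x) (part w x) (sc (E S x)) rdotC.
Qed.

(** The scalar measure of [v] is carried by [S].  The factor [sg] covers upper
    and lower bounds at the same time. *)
Lemma smeasure_integral_le S v (sg k : R) : measurable S -> E S v = v ->
  (forall l, S l -> sg * l <= k) -> sg * rd (c v) v <= k * rd v v.
Proof.
move=> mS Sv hk; have [mu [muE imu Imu]] := smeasure_measure v.
have muS : mu S = (rd v v)%:E by rewrite muE // Sv.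
have muC : mu (~` S) = 0.
  have mC := measurableC mS.
  by rewrite muE // -[in X in rd (E _ X)]Sv smeasure_orth ?rdot0l // setICr.
have TD : setT `\` (~` S) = S by rewrite setTD setCK.
have iS : mu.-integrable S (EFin \o (fun l : R => l)).
  exact: integrableS imu.
have JE : rd (c v) v = \int[mu]_(l in S) (l : R).
  have := Imu; rewrite (@negligible_integral _ _ _ mu setT (~` S)) //;
    last exact: measurableC.
  by rewrite TD /Rintegral => ->.
rewrite JE -RintegralZl //.
have <- : \int[mu]_(l in S) k = k * rd v v by rewrite Rintegral_cst // muS.
apply: le_Rintegral => //.
- exact: (integrableZl mS sg iS).
- apply: measurable_bounded_integrable => //; first by rewrite muS ltry.
  exists `|k|; split; first by rewrite num_real.
  by move=> K hK l _ /=; exact: ltW.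
Qed.

End SpectralMeasureProps.

(** * Cut down spectral projections *)

Section SpectralCut.
Local Open Scope complex_scope.
Context {R : realType} {H : completeNormedModType R[i]}.
Variable dot : {dot H for @Num.conj R[i]}.
Hypothesis Hdot : norm_from_dot dot.
Implicit Types (a b : H -> H) (x y z v : H).

Local Notation rd := (rdot dot).

(** The properties of the spectral projections [qm] and [qp] of [c] for
    [l < s] and [l <= s] that the minimization of shifted traces relies on;
    every spectral measure of [c] has them. *)
Record cut_spec (N : set (H -> H)) (e c : H -> H) (s : R) (qm qp : H -> H) :
    Prop := {
  cut_projm : proj_of dot N qm;
  cut_projp : proj_of dot N qp;
  cut_mp : forall x, qp (qm x) = qm x;
  cut_ep : forall x, e (qp x) = qp x;
  cut_commm : forall x, c (qm x) = qm (c x);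
  cut_commp : forall x, c (qp x) = qp (c x);
  cut_lt : forall v, qm v = v -> v != 0 -> rd (c v) v < s * rd v v;
  cut_eq : forall v, qp v = v -> qm v = 0 -> c v = s%:C *: v;
  cut_gt : forall v, e v = v -> qp v = 0 -> v != 0 -> s * rd v v < rd (c v) v }.

Section one_measure.
Variables (N : set (H -> H)) (e c : H -> H).
Variable E : set (measurableTypeR R) -> H -> H.
Hypothesis hE : spectral_measure dot N e c E.
Hypothesis bN : N `<=` bounded_op.
Hypotheses (lc : linear c) (sc : symmetric_op dot c).
Hypotheses (ce : forall x, c (e x) = c x) (ec : forall x, e (c x) = c x).

(** Strictness: if equality held, the vector would have no mass on any of
    the sets [Sn n], on which the integrand stays away from [k]. *)
Lemma smeasure_integral_lt (S : set (measurableTypeR R))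
    (Sn : nat -> set (measurableTypeR R)) v (sg k : R) :
  measurable S -> (forall n, measurable (Sn n)) -> S = \bigcup_n Sn n ->
  (forall l, S l -> sg * l <= k) ->
  (forall n l, Sn n l -> sg * l <= k - n.+1%:R^-1) ->
  E S v = v -> v != 0 -> sg * rd (c v) v < k * rd v v.
Proof.
move=> mS mSn SE hS hSn Sv; apply: contra_neqT; rewrite -leNgt => ge.
have sub n : Sn n `<=` S by rewrite SE; exact: bigcup_sup.
have null n : E (Sn n) v = 0.
  have [_ [[lE sE _] _] EE] := smeasure_proj hE bN (mSn n).
  set w := v - E (Sn n) v.
  have Ew : E (Sn n) w = 0 by rewrite /w (opB lE) EE subrr.
  have [_ [[lS _ _] _] _] := smeasure_proj hE bN mS.
  have Sw : E S w = w.
    by rewrite /w (opB lS) Sv (smeasure_sub hE bN _ (mSn n) mS (sub n)).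
  have h1 := smeasure_integral_le hE bN (mSn n) (EE v) (hSn n).
  have h2 := smeasure_integral_le hE bN mS Sw hS.
  have vE : v = E (Sn n) v + w by rewrite /w addrC subrK.
  have c0 : rd (c (E (Sn n) v)) w = 0.
    by rewrite (smeasure_commute hE bN lc sc ec) // sE Ew rdot0r.
  have v0 : rd (E (Sn n) v) w = 0 by rewrite sE Ew rdot0r.
  move: ge; rewrite vE (opD lc) -vE.
  move: (E (Sn n) v) w h1 h2 c0 v0 vE {Ew Sw} => p w h1 h2 c0 v0 ->.
  rewrite !rdotE c0 v0 (rdotC dot w p) v0 (sc w p) (rdotC dot w (c p)) c0.
  rewrite !addr0 !add0r => ge.
  have n0 : (0 : R) < n.+1%:R^-1 by rewrite invr_gt0 ltr0n.
  apply: (@rdot_eq0 _ _ dot); move: ge h1; rewrite !mulrDr mulrBl => ge h1.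
  move: (n.+1%:R^-1) n0 h1 => d n0 h1.
  have : d * rd p p <= 0 by lra.
  by rewrite pmulr_rle0 // => pp; have := rdot_ge0 dot p; lra.
have [mu [muE _ _]] := smeasure_measure hE v.
have : mu.-negligible S.
  rewrite SE; apply: negligible_bigcup => n.
  have h : mu (Sn n) = 0 by rewrite muE // null rdot0l.
  by apply/negligibleP.
move=> /(measure_negligible mS) muS0; have := muE S mS; rewrite Sv.
by rewrite [mu S]muS0 => -[/esym/rdot_eq0].
Qed.

Lemma spectral_measure_cut (s : R) :
  cut_spec N e c s (E [set` `]-oo, s[]) (E [set` `]-oo, s]]).
Proof.
have mm : measurable ([set` `]-oo, s[] : set (measurableTypeR R)).
  exact: measurable_itv.
have mp : measurable ([set` `]-oo, s]] : set (measurableTypeR R)).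
  exact: measurable_itv.
have ms : measurable ([set s] : set (measurableTypeR R)).
  exact: measurable_set1.
have mg : measurable ([set` `]s, +oo[] : set (measurableTypeR R)).
  exact: measurable_itv.
have mT := @measurableT _ (measurableTypeR R).
have [_ ET _] := hE.
have eE : e = E setT by rewrite ET.
have n0 n : (0 : R) < n.+1%:R^-1 by rewrite invr_gt0 ltr0n.
have near_lt (d : R) : 0 < d -> exists n : nat, n.+1%:R^-1 <= d.
  move=> d0; exists (Num.trunc d^-1).
  by rewrite invf_ple ?posrE ?ltr0n // ltW // truncnS_gt.
have unit x : e x = E [set` `]-oo, s]] x + E [set` `]s, +oo[] x.
  rewrite -(smeasure_add hE bN) // ?eE; last first.
    rewrite -subset0 => l [] /=; rewrite !in_itv /= andbT => ls.
    by rewrite ltNge ls.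
  congr (E _ x); apply/esym; rewrite -subTset => l _ /=.
  by rewrite !in_itv /= andbT; case: leP; [left|right].
have split_le x : E [set` `]-oo, s]] x = E [set` `]-oo, s[] x + E [set s] x.
  rewrite -(smeasure_add hE bN) //.
    congr (E _ x); apply/seteqP; split=> l /=; rewrite !in_itv /=.
      by rewrite le_eqVlt => /orP[/eqP|]; [right|left].
    by case=> [/ltW//|->].
  by rewrite -subset0 => l [] /= + ls; rewrite in_itv /= ls ltxx.
split.
- exact: smeasure_proj hE bN _ mm.
- exact: smeasure_proj hE bN _ mp.
- move=> x; apply: (smeasure_sub hE bN) => // l /=; rewrite !in_itv /=.
  exact: ltW.
- by move=> x; rewrite eE; exact: (smeasure_sub hE bN).
- by move=> x; exact: smeasure_commute hE bN lc sc ec _ _ mm.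
- by move=> x; exact: smeasure_commute hE bN lc sc ec _ _ mp.
- move=> v mv v0; rewrite -[rd (c v) v]mul1r.
  apply: (@smeasure_integral_lt [set` `]-oo, s[]
    (fun n => [set` `]-oo, s - n.+1%:R^-1]])) => //.
  + apply/seteqP; split=> l /=; rewrite in_itv /= => ls.
      have [|n hn] := near_lt (s - l); first by rewrite subr_gt0.
      by exists n => //=; rewrite in_itv /= lerBrDl -lerBrDr.
    case: ls => n _ /=; rewrite in_itv /= => /le_lt_trans; apply.
    by rewrite ltrBlDr ltrDl.
  + by move=> l /=; rewrite in_itv /= mul1r => /ltW.
  + by move=> n l /=; rewrite in_itv /= mul1r.
- move=> v pv mv.
  have sv : E [set s] v = v by rewrite -[RHS]pv split_le mv add0r.
  have [_ [[ls_ ss ps] _] es] := smeasure_proj hE bN ms.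
  have := @quadratic_ext _ _ dot (c \o E [set s]) (s%:C *: E [set s]).
  move=> /(_ _ _ _ _ _ v) h; rewrite -[in LHS]sv -[in RHS]sv; apply: h.
  + by move=> k x y; rewrite /= ls_ lc.
  + by move=> k x y; rewrite !op_scaleE ls_ scalerDr !scalerA mulrC.
  + move=> x y /=; rewrite sc ss.
    by rewrite (smeasure_commute hE bN lc sc ec _ ms).
  + by move=> x y; rewrite !op_scaleE !rdotE ss.
  move=> x /=; rewrite op_scaleE rdotZl.
  have -> : rd (c (E [set s] x)) x = rd (c (E [set s] x)) (E [set s] x).
    by rewrite -ss -(smeasure_commute hE bN lc sc ec _ ms) es.
  rewrite -(proj_rdot x (smeasure_proj hE bN ms)).
  have := smeasure_integral_le hE bN ms (es x) (sg := 1) (k := s).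
  have := smeasure_integral_le hE bN ms (es x) (sg := -1) (k := - s).
  rewrite mul1r !mulN1r mulNr lerN2 => h1 h2.
  apply/eqP; rewrite eq_le h1 ?h2 // => l /= ->; first by rewrite mul1r.
  by rewrite mulN1r.
move=> v ev pv v0.
have gv : E [set` `]s, +oo[] v = v by rewrite -[RHS]ev unit pv add0r.
rewrite -ltrN2 -mulNr -[X in X < _]mulN1r.
apply: (@smeasure_integral_lt [set` `]s, +oo[]
    (fun n => [set` `[s + n.+1%:R^-1, +oo[])) => //.
- apply/seteqP; split=> l /=; rewrite in_itv /= ?andbT => ls.
    have [|n hn] := near_lt (l - s); first by rewrite subr_gt0.
    by exists n => //=; rewrite in_itv /= andbT -lerBrDl.
  case: ls => n _ /=; rewrite in_itv /= andbT; apply: lt_le_trans.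
  by rewrite ltrDl.
- by move=> l /=; rewrite in_itv /= andbT mulN1r lerN2 => /ltW.
- by move=> n l /=; rewrite in_itv /= andbT mulN1r -opprD lerN2.
Qed.

End one_measure.

Variable M : set (H -> H).
Hypothesis HM : von_neumann_algebra dot M.

Lemma cut_spec_sub N N' e c s qm qp : N `<=` N' ->
  cut_spec N e c s qm qp -> cut_spec N' e c s qm qp.
Proof.
move=> NN' [[m1 m2 m3] [p1 p2 p3] h1 h2 h3 h4 h5 h6 h7].
by split=> //; split=> //; exact: NN'.
Qed.

Lemma cutP r b s : projection_in dot M r -> M b -> selfadjoint dot b ->
  cut_spec M r (r \o b \o r) s (cut_minus dot M r b s) (cut_plus dot M r b s).
Proof.
move=> pr Mb sb; have [Mr sr rr] := pr.
have rrE x : r (r x) = r x := congr1 (@^~ x) rr.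
pose c := r \o b \o r.
have Mc : M c by exact: (vn_comp HM (vn_comp HM Mr Mb) Mr).
have lc := vn_linear HM Mc.
have sc : symmetric_op dot c.
  move=> x y; rewrite /c /= (selfadjoint_symmetric sr).
  by rewrite (selfadjoint_symmetric sb) (selfadjoint_symmetric sr).
have sac := symmetric_selfadjoint lc sc.
have rc : r \o c = c by apply/funext => x; rewrite /c /= rrE.
have cr : c \o r = c by apply/funext => x; rewrite /c /= rrE.
have exE := exists_corner_spectral_measure Hdot HM pr Mc sac rc cr.
have sub : corner M r `<=` M.
  by move=> _ [a Ma <-]; exact: (vn_comp HM (vn_comp HM Mr Ma) Mr).
apply: (cut_spec_sub sub).
apply: spectral_measure_cut => //.
- exact: (xgetPex _ exE).
- exact: subset_trans sub (vn_bounded HM).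
- by move=> x; exact: (congr1 (@^~ x) rc).
Qed.

Lemma corner_id : corner M idfun = M.
Proof.
apply/seteqP; split=> [_ [a Ma <-] //|a Ma].
by exists a.
Qed.

End SpectralCut.

(** * The trace *)

Section Trace.
Local Open Scope complex_scope.
Context {R : realType} {H : completeNormedModType R[i]}.
Variable dot : {dot H for @Num.conj R[i]}.
Hypothesis Hdot : norm_from_dot dot.
Implicit Types (a b : H -> H) (x y z v : H).

Local Notation rd := (rdot dot).

Variable M : set (H -> H).
Hypothesis HM : von_neumann_algebra dot M.
Variable tau : (H -> H) -> R[i].
Hypothesis Htau : faithful_normal_tracial_state dot M tau.

Definition rtrace a : R := complex.Re (tau a).
Local Notation T := rtrace.

Lemma rtraceD a b : M a -> M b -> T (a + b) = T a + T b.
Proof.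
by move=> Ma Mb; rewrite /T -[a in LHS]scale1r (tr_linear Htau) // mul1r ReD.
Qed.

Lemma rtrace0 : T 0 = 0.
Proof.
have M0 := vn_0 HM; have := rtraceD M0 M0; rewrite addr0 => /eqP.
by rewrite eq_sym -subr_eq0 addrK => /eqP.
Qed.

Lemma rtraceZ (k : R) a : M a -> T (k%:C *: a) = k * T a.
Proof.
move=> Ma; rewrite /T -[_ *: a]addr0 (tr_linear Htau) //; last exact: vn_0 HM.
by rewrite ReD ReM_real -/(T 0) rtrace0 addr0.
Qed.

Lemma rtraceB a b : M a -> M b -> T (a - b) = T a - T b.
Proof.
move=> Ma Mb; have -> : a - b = a + (-1)%:C *: b.
  by rewrite rmorphN rmorph1 scaleN1r.
by rewrite rtraceD ?rtraceZ ?mulN1r //; exact: (vn_scale HM).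
Qed.

Lemma rtraceC a b : M a -> M b -> T (a \o b) = T (b \o a).
Proof. by move=> Ma Mb; rewrite /T (tr_trace Htau). Qed.

Lemma positive_pos_op a : positive_op dot a -> pos_op dot a.
Proof. by move=> [la sa pa]; exact: rdot_pos. Qed.

Lemma rtrace_ge0 a : M a -> positive_op dot a -> 0 <= T a.
Proof.
move=> Ma /positive_pos_op pa; have := tr_pos Htau Ma pa.
by rewrite /T; case: (tau a) => u v; rewrite lecE /= => /andP[].
Qed.

Lemma rtrace_faithful a : M a -> positive_op dot a -> T a = 0 -> a = 0.
Proof.
move=> Ma /positive_pos_op pa Ta; apply: (tr_faithful Htau) => //.
have := tr_pos Htau Ma pa; move: Ta; rewrite /T; case: (tau a) => u v /= ->.
by rewrite lecE /= => /andP[/eqP-> _].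
Qed.

Lemma iter_square_mem a n : M a -> M (iter_square a n).
Proof.
move=> Ma; elim: n => // n IH.
exact: (vn_sub HM IH (vn_comp HM IH IH)).
Qed.

Lemma positive_conj a b : linear a -> symmetric_op dot a ->
  positive_op dot b -> positive_op dot (a \o b \o a).
Proof.
move=> la sa [lb sb pb]; split.
- by move=> k x y; rewrite /= la lb la.
- by move=> x y /=; rewrite sa sb sa.
- by move=> x /=; rewrite sa.
Qed.

(** Writing a positive contraction [a] as the sum of the squares of the
    [iter_square a n] turns [tau (a b)] into a sum of traces of the positive
    operators [a_n b a_n]; the remainder is controlled by the Cauchy-Schwarz
    inequality for the trace. *)
Lemma rtrace_mul_ge0 a b : M a -> M b -> effect dot a -> positive_op dot b ->
  0 <= T (a \o b).
Proof.
move=> Ma Mb ea pb; pose u n := iter_square a n.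
have Mu n : M (u n) := iter_square_mem n Ma.
have eu n : effect dot (u n) := iter_square_effect n ea.
have comp := vn_comp HM.
have uS n : u n.+1 = u n - (u n \o u n) by [].
have lb := vn_linear HM Mb.
apply: (@telescoping_ge0 _ (fun n => T (u n \o b)) (fun n => T (u n))
  (T (b \o b))).
- move=> n; rewrite uS.
  have -> : (u n - (u n \o u n)) \o b = (u n \o b) - (u n \o (u n \o b)) by [].
  have Mub := comp _ _ (Mu n) Mb; have Muub := comp _ _ (Mu n) Mub.
  rewrite rtraceB // gerDl oppr_le0 rtraceC //.
  apply: rtrace_ge0; first exact: comp.
  exact: positive_conj (pos_lin (eu n)) (pos_sym (eu n)) pb.
- by move=> n; exact: rtrace_ge0 (Mu n) (eff_pos (eu n)).
- apply: rtrace_ge0; first exact: comp.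
  exact: positive_square lb (pos_sym pb).
move=> n e e0; rewrite uS rtraceB //; last exact: comp.
rewrite subKr; apply: young_lower_bound => //.
- move=> t.
  have Mt : M (t%:C *: b) := vn_scale HM _ Mb.
  have Ms := vn_add HM (Mu n) Mt.
  have ls := vn_linear HM Ms.
  have : 0 <= T ((u n + t%:C *: b) \o (u n + t%:C *: b)).
    apply: rtrace_ge0; first exact: comp.
    apply: positive_square => // x y.
    by rewrite !op_addE !op_scaleE !rdotE (pos_sym (eu n)) (pos_sym pb).
  have lu := vn_linear HM (Mu n).
  have -> : (u n + t%:C *: b) \o (u n + t%:C *: b) =
    (u n \o u n) + t%:C *: ((u n \o b) + (b \o u n)) + (t * t)%:C *: (b \o b).
    apply/funext => x /=; rewrite !op_addE !op_scaleE !op_addE /=.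
    rewrite (opD lu) (opZ lu) (opD lb) (opZ lb) !scalerDr scalerA -rmorphM.
    by rewrite -!addrA.
  rewrite rtraceD; last 2 first.
  - apply: (vn_add HM); first exact: comp.
    by apply/(vn_scale HM)/(vn_add HM); exact: comp.
  - by apply: (vn_scale HM); exact: comp.
  rewrite rtraceD; last 2 first.
  - exact: comp.
  - by apply/(vn_scale HM)/(vn_add HM); exact: comp.
  rewrite rtraceZ; last by apply: (vn_add HM); exact: comp.
  rewrite rtraceZ; last exact: comp.
  rewrite rtraceD; try exact: comp.
  rewrite (rtraceC Mb (Mu n)); congr (_ <= _); ring.
- by apply: rtrace_ge0; [exact: comp|exact: positive_square (pos_lin (eu n))
    (pos_sym (eu n))].
- by apply: rtrace_ge0; [exact: comp|exact: positive_square lb (pos_sym pb)].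
Qed.

(** The first square split off from [a] shows [tau (a b a) <= tau (a b) = 0], to
    which faithfulness applies. *)
Lemma rtrace_mul_eq0 a b : M a -> M b -> effect dot a -> positive_op dot b ->
  T (a \o b) = 0 -> forall x, b (a x) = 0.
Proof.
move=> Ma Mb ea pb Tab x.
have comp := vn_comp HM.
have h : 0 <= T ((a - (a \o a)) \o b).
  apply: rtrace_mul_ge0 => //; last exact: complement_square_effect.
  by apply: (vn_sub HM) => //; exact: comp.
have Mab := comp _ _ Ma Mb; have Maab := comp _ _ Ma Mab.
have Maba : M (a \o b \o a) by exact: comp.
have paba := positive_conj (pos_lin ea) (pos_sym ea) pb.
have aba : a \o b \o a = 0.
  apply: rtrace_faithful => //; apply/eqP; rewrite eq_le rtrace_ge0 // andbT.
  move: h; have -> : (a - (a \o a)) \o b = (a \o b) - (a \o (a \o b)) by [].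
  by rewrite rtraceB // Tab sub0r oppr_ge0 rtraceC.
apply: (pos_ker (pos_lin pb) (pos_sym pb) (pos_ge0 pb)).
have := congr1 (fun f => rd (f x) x) aba.
by rewrite /= rdot0l (pos_sym ea).
Qed.

End Trace.

(** * Minimizers of a shifted trace *)

Section Minimizers.
Local Open Scope complex_scope.
Context {R : realType} {H : completeNormedModType R[i]}.
Variable dot : {dot H for @Num.conj R[i]}.
Hypothesis Hdot : norm_from_dot dot.
Implicit Types (a b p q : H -> H) (x y z v : H).

Local Notation rd := (rdot dot).

Definition form_le a b : Prop := forall v, rd (a v) v <= rd (b v) v.

Variable M : set (H -> H).
Hypothesis HM : von_neumann_algebra dot M.
Variable tau : (H -> H) -> R[i].
Hypothesis Htau : faithful_normal_tracial_state dot M tau.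
Local Notation T := (rtrace tau).

(** For symmetric [p] and [q] with [q <= 1] this is [op_interval], see
    [op_intervalE], in a form that only involves real numbers. *)
Definition form_interval p q : set (H -> H) :=
  [set a | [/\ M a, positive_op dot a, form_le p a & form_le a q]].

Lemma form_le_op p q : M p -> M q -> symmetric_op dot p -> symmetric_op dot q ->
  form_le p q -> le_op dot p q.
Proof.
move=> Mp Mq sp sq pq; apply: rdot_pos.
- exact: (vn_linear HM (vn_sub HM Mq Mp)).
- by move=> x y; rewrite !op_subE !rdotE sp sq.
- by move=> x; rewrite op_subE rdotDl rdotNl subr_ge0.
Qed.

Lemma op_intervalE p q : M p -> symmetric_op dot p -> M q ->
  symmetric_op dot q -> form_le q idfun ->
  op_interval dot M p q = form_interval p q.
Proof.
move=> Mp sp Mq sq q1; apply/seteqP; split=> a.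
  move=> [[Ma pa _] pl qu]; have la := vn_linear HM Ma.
  split=> //.
  - split=> //; first exact: pos_symmetric.
    by move=> x; exact: pos_rdot.
  - move=> v; have := pos_rdot v pl; rewrite op_subE rdotDl rdotNl; lra.
  - move=> v; have := pos_rdot v qu; rewrite op_subE rdotDl rdotNl; lra.
move=> [Ma pa pl qu]; have [la sa a0] := pa.
split; [split=> //|exact: form_le_op|exact: form_le_op].
  exact: positive_pos_op.
apply: form_le_op => //; first exact: (vn_id HM).
by move=> v; apply: le_trans (qu v) (q1 v).
Qed.

Lemma form_le_proj_kernel a q v : positive_op dot a -> form_le a q ->
  q v = 0 -> a v = 0.
Proof.
move=> [la sa pa] aq qv; apply: (pos_ker la sa pa).
have := aq v; rewrite qv rdot0l; have := pa v; lra.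
Qed.

Lemma proj_absorb a q v : proj_of dot M q -> positive_op dot a ->
  form_le a q -> a (q v) = a v.
Proof.
move=> [Mq eq_ qq] pa aq; have [la sa _] := pa.
have h : a (v - q v) = 0.
  by apply: (form_le_proj_kernel pa aq); rewrite (opB (pos_lin eq_)) qq subrr.
by move/eqP: h; rewrite (opB la) subr_eq0 => /eqP.
Qed.

Lemma proj_absorb_l a q v : proj_of dot M q -> positive_op dot a ->
  form_le a q -> q (a v) = a v.
Proof.
move=> pq pa aq; apply: (rdot_ext (dot := dot)) => z.
rewrite (pos_sym (proj_eff pq)) (pos_sym pa) (proj_absorb _ pq pa aq).
by rewrite -(pos_sym pa).
Qed.

Section cut.
Variables (r c : H -> H) (s : R) (qm qp : H -> H).
Hypothesis (pr : proj_of dot M r) (Mc : M c) (sc : symmetric_op dot c).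
Hypothesis (cr : forall x, c (r x) = c x) (rc : forall x, r (c x) = c x).
Hypothesis hcut : cut_spec dot M r c s qm qp.

Let Mr := proj_mem pr.
Let pm := cut_projm hcut.
Let pp := cut_projp hcut.
Let Mm := proj_mem pm.
Let Mp := proj_mem pp.
Let lr := vn_linear HM Mr.
Let lm := vn_linear HM Mm.
Let lp := vn_linear HM Mp.
Let lc := vn_linear HM Mc.

Lemma cut_pm x : qm (qp x) = qm x.
Proof.
apply: (rdot_ext (dot := dot)) => z.
rewrite (pos_sym (proj_eff pm)) (pos_sym (proj_eff pp)) (cut_mp hcut).
by rewrite -(pos_sym (proj_eff pm)).
Qed.

Lemma cut_pe x : qp (r x) = qp x.
Proof.
apply: (rdot_ext (dot := dot)) => z.
rewrite (pos_sym (proj_eff pp)) (pos_sym (proj_eff pr)) (cut_ep hcut).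
by rewrite -(pos_sym (proj_eff pp)).
Qed.

Lemma cut_em x : r (qm x) = qm x.
Proof. by rewrite -(cut_mp hcut) (cut_ep hcut). Qed.

Lemma cut_me x : qm (r x) = qm x.
Proof. by rewrite -cut_pm cut_pe cut_pm. Qed.

Lemma proj_form_le p q : proj_of dot M p -> proj_of dot M q ->
  (forall x, q (p x) = p x) -> form_le p q.
Proof.
move=> hp hq qp_ v; rewrite -(proj_rdot v hp) -(proj_rdot v hq).
have pq : p (q v) = p v.
  apply: (rdot_ext (dot := dot)) => z.
  rewrite (pos_sym (proj_eff hp)) (pos_sym (proj_eff hq)) qp_.
  by rewrite -(pos_sym (proj_eff hp)).
have := eff_le1 (proj_eff hp) (q v); rewrite -(proj_rdot _ hp) pq; exact.
Qed.

Lemma cut_form_le : form_le qm qp. Proof. exact: proj_form_le (cut_mp hcut).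
  Qed.
Lemma cut_form_lep : form_le qp r. Proof. exact: proj_form_le (cut_ep hcut).
  Qed.
Lemma cut_form_lem : form_le qm r. Proof. exact: proj_form_le cut_em. Qed.

(** The part of [c - s] carried by a projection that commutes with [c]. *)
Let shifted p : H -> H := (c \o p) - s%:C *: p.

Let shiftedE p x : shifted p x = c (p x) - s%:C *: p x. Proof. by []. Qed.

Let Mshift p : M p -> M (shifted p).
Proof.
by move=> Mp'; apply: (vn_sub HM); [exact: (vn_comp HM)|exact: (vn_scale HM)].
Qed.

Let shift_sym p : proj_of dot M p -> (forall x, c (p x) = p (c x)) ->
  symmetric_op dot (shifted p).
Proof.
move=> hp cp x y; rewrite !shiftedE !rdotE (pos_sym (proj_eff hp)) sc.
by rewrite (pos_sym (proj_eff hp)) cp.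
Qed.

Let shift_form p v : proj_of dot M p -> (forall x, c (p x) = p (c x)) ->
  rd (shifted p v) v = rd (c (p v)) (p v) - s * rd (p v) (p v).
Proof.
move=> hp cp; rewrite shiftedE !rdotE (proj_rdot v hp); congr (_ - _).
by rewrite -(pos_sym (proj_eff hp)) -cp (proj_idem hp).
Qed.

Let qg : H -> H := r - qp.

Let pg : proj_of dot M qg.
Proof.
have [[l1 s1 p1] h1] := proj_eff pr; have [[l2 s2 p2] h2] := proj_eff pp.
split; first exact: (vn_sub HM).
  apply: effect_sub => //.
  exact: cut_form_lep.
move=> x; rewrite /qg !op_subE (opB l1) (opB l2) (proj_idem pr) (cut_ep hcut).
by rewrite cut_pe (proj_idem pp) subrr subr0.
Qed.

Let cg x : c (qg x) = qg (c x).
Proof. by rewrite /qg !op_subE (opB lc) (cut_commp hcut) cr rc. Qed.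

Let up : H -> H := shifted qg.
Let down : H -> H := - shifted qm.

Let up_pos : positive_op dot up.
Proof.
have Mg := proj_mem pg; split.
- by apply: (vn_linear HM); exact: Mshift.
- exact: shift_sym.
move=> v; rewrite shift_form //; have [->|g0] := eqVneq (qg v) 0.
  by rewrite !rdot0r mulr0 subrr.
rewrite subr_ge0; apply/ltW/(cut_gt hcut) => //.
- by rewrite /qg op_subE (opB lr) (proj_idem pr) (cut_ep hcut).
- by rewrite /qg op_subE (opB lp) cut_pe (proj_idem pp) subrr.
Qed.

Let down_pos : positive_op dot down.
Proof.
have Md : M down by rewrite /down -scaleN1r; exact: (vn_scale HM _ (Mshift Mm)).
split.
- by apply: (vn_linear HM).
- move=> x y; rewrite /down /=.
  have -> z : (- shifted qm) z = - shifted qm z by [].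
  rewrite rdotNl rdotNr; congr (- _).
  exact: shift_sym pm (cut_commm hcut) x y.
move=> v; have -> : down v = - shifted qm v by [].
rewrite rdotNl shift_form //; last exact: cut_commm hcut.
have [->|g0] := eqVneq (qm v) 0; first by rewrite !rdot0r mulr0 subrr oppr0.
by rewrite oppr_ge0 subr_le0; apply/ltW/(cut_lt hcut); rewrite ?(proj_idem pm).
Qed.

Let mid_eq x : c (qp x) - c (qm x) = s%:C *: (qp x - qm x).
Proof.
rewrite -(opB lc); apply: (cut_eq hcut).
  by rewrite (opB lp) (proj_idem pp) (cut_mp hcut).
by rewrite (opB lm) cut_pm (proj_idem pm) subrr.
Qed.

Let shift_split x : c x - s%:C *: r x = up x - down x.
Proof.
have -> : up x - down x = shifted qg x + shifted qm x by rewrite /down opprK.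
have e : c (qm x) - s%:C *: qm x = c (qp x) - s%:C *: qp x.
  have /eqP := mid_eq x; rewrite scalerBr subr_eq => /eqP ->.
  by rewrite addrAC [_ - _ - _]addrAC subrr sub0r addrC.
rewrite !shiftedE e /qg !op_subE (opB lc) cr scalerBr opprB addrACA subrK.
by rewrite [_ - _ - _]addrAC subrr sub0r.
Qed.

Definition shifted_trace a : R := T (c \o a) - s * T a.
Local Notation f := shifted_trace.

(** [up] and [down] are the positive and the negative part of [c - s] on the
    range of [r], so that both terms are traces of products of positive
    operators. *)
Lemma shifted_trace_diff a : M a -> positive_op dot a -> form_le a r ->
  f a - f qm = T (a \o up) + T ((r - a) \o down).
Proof.
move=> Ma pa ar.
have comp := vn_comp HM.
have Mup : M up := Mshift (proj_mem pg).
have Mdown : M down by rewrite /down -scaleN1r;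
  exact: (vn_scale HM _ (Mshift Mm)).
have la := vn_linear HM Ma.
have -> : (r - a) \o down = down - (a \o down).
  apply/funext => x; have -> :
    ((r - a) \o down) x = r (down x) - a (down x) by [].
  rewrite op_subE /=; congr (_ - _).
  have dE : down x = s%:C *: qm x - c (qm x).
    have -> : down x = - shifted qm x by [].
    by rewrite shiftedE opprB.
  by rewrite dE (opB lr) (opZ lr) cut_em rc.
rewrite (rtraceB HM Htau) //; last exact: comp.
have -> : T down = - (T (c \o qm) - s * T qm).
  have -> : down = s%:C *: qm - (c \o qm) by rewrite /down opprB.
  by rewrite (rtraceB HM Htau) ?(rtraceZ HM Htau) ?opprB //;
    [exact: (vn_scale HM)|exact: comp].
have : T (a \o up) - T (a \o down) = f a.
  rewrite -(rtraceB HM Htau); try exact: comp.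
  have -> : (a \o up) - (a \o down) = (a \o c) - s%:C *: a.
    apply/funext => x.
    have -> : ((a \o up) - (a \o down)) x = a (up x) - a (down x) by [].
    rewrite -(opB la) -shift_split (opB la) (opZ la)
      (proj_absorb _ pr pa ar) //.
  rewrite (rtraceB HM Htau) ?(rtraceZ HM Htau) //.
  - by rewrite (rtraceC Htau).
  - exact: comp.
  - exact: (vn_scale HM).
rewrite /f; lra.
Qed.

Let eff_a a : M a -> positive_op dot a -> form_le a r -> effect dot a.
Proof.
move=> Ma pa ar; split=> // v; apply: le_trans (ar v) _.
exact: eff_le1 (proj_eff pr) v.
Qed.

Let eff_ra a : M a -> positive_op dot a -> form_le a r -> effect dot (r - a).
Proof.
by move=> Ma pa ar; apply: effect_sub => //; [exact: proj_eff pr|exact: eff_a].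
Qed.

Let Mup : M up := Mshift (proj_mem pg).
Let Mdown : M down.
Proof. by rewrite /down -scaleN1r; exact: (vn_scale HM _ (Mshift Mm)). Qed.

Let trace_up_ge0 a : M a -> positive_op dot a -> form_le a r ->
  0 <= T (a \o up).
Proof.
move=> Ma pa ar.
exact: (rtrace_mul_ge0 HM Htau Ma Mup (eff_a Ma pa ar) up_pos).
Qed.

Let trace_down_ge0 a : M a -> positive_op dot a -> form_le a r ->
  0 <= T ((r - a) \o down).
Proof.
move=> Ma pa ar.
exact: (rtrace_mul_ge0 HM Htau (vn_sub HM Mr Ma) Mdown
  (eff_ra Ma pa ar) down_pos).
Qed.

Lemma shifted_trace_min a : M a -> positive_op dot a -> form_le a r ->
  f qm <= f a.
Proof.
move=> Ma pa ar; rewrite -subr_ge0 shifted_trace_diff //.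
exact: addr_ge0 (trace_up_ge0 Ma pa ar) (trace_down_ge0 Ma pa ar).
Qed.

(** Both traces vanish, hence [up] kills the range of [a] and [down] that of
    [r - a].  As [c - s] is strictly positive above [qp] and strictly negative
    below [qm], this means [a = qp a] and [qm a = qm]. *)
Lemma shifted_trace_argmin a : M a -> positive_op dot a -> form_le a r ->
  f a = f qm -> form_le qm a /\ form_le a qp.
Proof.
move=> Ma pa ar fa; have la := vn_linear HM Ma.
have ge1 := trace_up_ge0 Ma pa ar; have ge2 := trace_down_ge0 Ma pa ar.
have /eqP := shifted_trace_diff Ma pa ar; rewrite fa subrr eq_sym.
rewrite paddr_eq0 // => /andP[/eqP t1 /eqP t2].
have u0 v : up (a v) = 0 :=
  rtrace_mul_eq0 HM Htau Ma Mup (eff_a Ma pa ar) up_pos t1 v.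
have d0 v : down ((r - a) v) = 0 :=
  rtrace_mul_eq0 HM Htau (vn_sub HM Mr Ma) Mdown
    (eff_ra Ma pa ar) down_pos t2 v.
have g0 v : qg (a v) = 0.
  apply/eqP/negPn/negP => n0; have := shift_form (a v) pg cg.
  rewrite -/up u0 rdot0l => /eqP; rewrite eq_sym subr_eq0 => /eqP h.
  have := cut_gt hcut (v := qg (a v)); rewrite h ltxx => hh.
  suff : false by []. apply: hh => //.
  - by rewrite /qg op_subE (opB lr) (proj_idem pr) (cut_ep hcut).
  - by rewrite /qg op_subE (opB lp) cut_pe (proj_idem pp) subrr.
have m0 v : qm ((r - a) v) = 0.
  apply/eqP/negPn/negP => n0;
    have := shift_form ((r - a) v) pm (cut_commm hcut).
  have -> : shifted qm ((r - a) v) = - down ((r - a) v) by rewrite /down opprK.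
  rewrite d0 oppr0 rdot0l => /eqP; rewrite eq_sym subr_eq0 => /eqP h.
  have := cut_lt hcut (proj_idem pm ((r - a) v)) n0; rewrite h ltxx //.
have apa v : qp (a v) = a v.
  have := g0 v; rewrite /qg op_subE (proj_absorb_l _ pr pa ar) => /eqP.
  by rewrite subr_eq0 => /eqP.
have qma v : qm (a v) = qm v.
  have := m0 v; rewrite op_subE (opB lm) cut_me => /eqP.
  by rewrite subr_eq0 => /eqP.
have sa := pos_sym pa.
have aqp v : a (qp v) = a v.
  apply: (rdot_ext (dot := dot)) => z.
  by rewrite sa (pos_sym (proj_eff pp)) apa -sa.
have aqm v : a (qm v) = qm v.
  apply: (rdot_ext (dot := dot)) => z.
  by rewrite sa (pos_sym (proj_eff pm)) qma -(pos_sym (proj_eff pm)).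
split=> v.
  have := pos_ge0 pa (v - qm v); rewrite (opB la) aqm !rdotE.
  rewrite (proj_rdot v pm) (sa v (qm v)) aqm (rdotC _ v); lra.
rewrite -apa (pos_sym (proj_eff pp)) -(aqp v).
apply: le_trans (eff_le1 (eff_a Ma pa ar) (qp v)) _.
by rewrite (proj_rdot v pp).
Qed.

Lemma shifted_trace_argminW a : M a -> positive_op dot a ->
  form_le qm a -> form_le a qp -> f a = f qm.
Proof.
move=> Ma pa ma ap.
have ar : form_le a r by move=> v; exact: le_trans (ap v) (cut_form_lep v).
apply/eqP; rewrite -subr_eq0 shifted_trace_diff //.
have -> : a \o up = 0.
  apply/funext => x; apply: (form_le_proj_kernel pa ap).
  rewrite /up shiftedE (opB lp) (opZ lp) -(cut_commp hcut).
  have -> : qp (qg x) = 0.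
    by rewrite /qg op_subE (opB lp) cut_pe (proj_idem pp) subrr.
  by rewrite (op0 lc) scaler0 subrr.
have -> : (r - a) \o down = 0.
  apply/funext => x /=; have [pra _] := eff_ra Ma pa ar.
  have mw : qm (down x) = down x.
    have dE : down x = s%:C *: qm x - c (qm x).
      have -> : down x = - shifted qm x by [].
      by rewrite shiftedE opprB.
    by rewrite dE (opB lm) (opZ lm) -(cut_commm hcut) (proj_idem pm).
  apply: (pos_ker (pos_lin pra) (pos_sym pra) (pos_ge0 pra)).
  have := pos_ge0 pra (down x); rewrite op_subE rdotDl rdotNl.
  have := ma (down x); rewrite mw.
  have := eff_le1 (proj_eff pr) (down x); lra.
by rewrite (rtrace0 HM Htau) addr0.
Qed.

End cut.
End Minimizers.

(** * Exposed faces of the spectral scale *)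

Section Scale.
Local Open Scope complex_scope.
Context {R : realType} {H : completeNormedModType R[i]}.
Variable dot : {dot H for @Num.conj R[i]}.
Hypothesis Hdot : norm_from_dot dot.
Implicit Types (a p q Q r : H -> H) (x y z v : H).

Local Notation rd := (rdot dot).

Variable M : set (H -> H).
Hypothesis HM : von_neumann_algebra dot M.
Variable tau : (H -> H) -> R[i].
Hypothesis Htau : faithful_normal_tracial_state dot M tau.
Local Notation T := (rtrace tau).
Local Notation FI := (form_interval dot M).

Variables (n : nat) (n_gt0 : (0 < n)%N).
Variable b : 'I_n -> H -> H.
Hypotheses (Mb : forall i, M (b i)) (sab : forall i, selfadjoint dot (b i)).
Local Notation Psi := (Psi tau b).

Lemma rtrace_sum (I : finType) (F : I -> H -> H) : (forall i, M (F i)) ->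
  T (\sum_i F i) = \sum_i T (F i).
Proof.
move=> MF; suff [_ //] : M (\sum_i F i) /\ T (\sum_i F i) = \sum_i T (F i).
elim/big_ind2: _ => //.
- by split; [exact: vn_0 HM|exact: (rtrace0 HM Htau)].
- move=> a k p l [Ma Ta] [Mp Tp]; split; first exact: (vn_add HM).
  by rewrite (rtraceD Htau) // Ta Tp.
Qed.

Lemma comb_mem t : M (comb b t).
Proof. by apply: (vn_sum HM) => i; exact: (vn_scale HM). Qed.

Lemma comb_selfadjoint t : selfadjoint dot (comb b t).
Proof.
apply: symmetric_selfadjoint; first by apply: (vn_linear HM); exact: comb_mem.
rewrite /comb; elim/big_ind: _ => //.
- by move=> x y; rewrite /= rdot0l rdot0r.
- by move=> p q sp sq x y; rewrite !op_addE !rdotE sp sq.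
move=> i _ x y; rewrite !op_scaleE !rdotE.
by rewrite (selfadjoint_symmetric (sab i)).
Qed.

Lemma PsiD a p : M a -> M p -> Psi (a + p) = Psi a + Psi p.
Proof.
move=> Ma Mp; apply/rowP => j; rewrite !mxE.
case: unliftP => [i _|_]; last exact: (rtraceD Htau Ma Mp).
have -> : b i \o (a + p) = (b i \o a) + (b i \o p).
  by apply/funext => x; rewrite /= op_addE (opD (vn_linear HM (Mb i))).
by apply: (rtraceD Htau); exact: (vn_comp HM).
Qed.

Lemma Psi0 : Psi 0 = 0.
Proof.
have M0 := vn_0 HM; have := PsiD M0 M0; rewrite addr0 => /eqP.
by rewrite eq_sym -subr_eq0 addrK => /eqP.
Qed.

Definition tail_row (u : 'rV[R]_n.+1) : 'rV[R]_n :=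
  \row_i u 0 (lift ord0 i).

(** Linear functionals on the scale are shifted traces
    [a |-> tau ((b_t - s) a)], with [t] the tail of [u] and [s] the opposite of
    its first entry. *)
Lemma dotrv_Psi (u : 'rV[R]_n.+1) a : M a ->
  dotrv u (Psi a) = T (comb b (tail_row u) \o a) + u 0 ord0 * T a.
Proof.
move=> Ma; rewrite /dotrv big_ord_recl addrC mxE unlift_none; congr (_ + _).
have -> : comb b (tail_row u) \o a =
    \sum_(i < n) (u 0 (lift ord0 i))%:C *: (b i \o a).
  apply/funext => x; rewrite /comb /= !fct_sumE; apply: eq_bigr => i _.
  by rewrite mxE.
rewrite rtrace_sum; last first.
  by move=> i; apply: (vn_scale HM); exact: (vn_comp HM).
apply: eq_bigr => i _; rewrite mxE liftK (rtraceZ HM Htau) //.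
exact: (vn_comp HM).
Qed.

Lemma dotrvD (u w1 w2 : 'rV[R]_n.+1) :
  dotrv u (w1 + w2) = dotrv u w1 + dotrv u w2.
Proof.
by rewrite /dotrv -big_split; apply: eq_bigr => i _; rewrite mxE mulrDr.
Qed.

Lemma dotrvN (u w : 'rV[R]_n.+1) : dotrv (- u) w = - dotrv u w.
Proof.
by rewrite /dotrv -sumrN; apply: eq_bigr => i _; rewrite mxE mulNr.
Qed.

Lemma proj_of_projection p : proj_of dot M p -> projection_in dot M p.
Proof.
move=> [Mp [[lp sp _] _] pp]; split=> //; first exact: symmetric_selfadjoint.
by apply/funext.
Qed.

Lemma proj_of_idfun : proj_of dot M idfun.
Proof. by split=> //; [exact: vn_id HM|exact: id_effect]. Qed.

Section stage.
Variable r : H -> H.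
Hypothesis pr : proj_of dot M r.
Let Mr := proj_mem pr.

Let compr t := r \o comb b t \o r.

Let compr_mem t : M (compr t).
Proof. exact: (vn_comp HM (vn_comp HM Mr (comb_mem t)) Mr). Qed.

Let compr_sym t : symmetric_op dot (compr t).
Proof.
have sr := pos_sym (proj_eff pr).
move=> x y; rewrite /compr /= sr.
by rewrite (selfadjoint_symmetric (comb_selfadjoint t)) sr.
Qed.

Let compr_r t x : compr t (r x) = compr t x.
Proof. by rewrite /compr /= (proj_idem pr). Qed.

Let r_compr t x : r (compr t x) = compr t x.
Proof. by rewrite /compr /= (proj_idem pr). Qed.

Lemma stage_cut t s : cut_spec dot M r (compr t) s
  (cut_minus dot M r (comb b t) s) (cut_plus dot M r (comb b t) s).
Proof.
exact: (cutP Hdot HM s (proj_of_projection pr) (comb_mem t)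
  (comb_selfadjoint t)).
Qed.

Lemma rtrace_compress t a : a \in FI 0 r ->
  T (comb b t \o a) = T (compr t \o a).
Proof.
rewrite inE => -[Ma pa _ ar]; have Mba := vn_comp HM (comb_mem t) Ma.
have -> : compr t \o a = r \o (comb b t \o a).
  by apply/funext => x; rewrite /compr /= (proj_absorb_l x pr pa ar).
rewrite [RHS](rtraceC Htau Mr Mba).
have -> // : (comb b t \o a) \o r = comb b t \o a.
by apply/funext => x; rewrite /= (proj_absorb x pr pa ar).
Qed.

(** A functional that is a multiple of the trace is extreme at [0] or at [r]
    only; for [s] outside the spectrum of the compressed element, these points
    are order intervals of cut down projections too. *)
Lemma extreme_cuts t : exists2 K : R, 0 <= K &
  (forall s, s < - K -> cut_minus dot M r (comb b t) s = 0 /\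
                        cut_plus dot M r (comb b t) s = 0) /\
  (forall s, K < s -> cut_minus dot M r (comb b t) s = r /\
                      cut_plus dot M r (comb b t) s = r).
Proof.
have [K K0 cK] := bounded_form_bound Hdot (vn_bounded HM (compr_mem t)).
exists K => //.
split=> s hs; have hc := stage_cut t s.
  set qm := cut_minus _ _ _ _ _ in hc *; set qp := cut_plus _ _ _ _ _ in hc *.
  have qm0 x : qm x = 0.
    apply/eqP/negPn/negP => n0.
    have := cut_lt hc (proj_idem (cut_projm hc) x) n0.
    have := cK (qm x); rewrite ler_norml => /andP[h1 _].
    have := rdot_ge0 dot (qm x); nra.
  split; apply/funext => x //.
  have e := cut_eq hc (proj_idem (cut_projp hc) x) (qm0 _).
  apply: (@rdot_eq0 _ _ dot); have := cK (qp x).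
  rewrite e rdotZl ler_norml => /andP[h1 _].
  by apply: (ge0_mul_lt_eq0 (rdot_ge0 dot (qp x)) hs); rewrite mulNr.
set qm := cut_minus _ _ _ _ _ in hc *; set qp := cut_plus _ _ _ _ _ in hc *.
have lp := vn_linear HM (proj_mem (cut_projp hc)).
have lr := vn_linear HM Mr.
have lm := vn_linear HM (proj_mem (cut_projm hc)).
have qpr x : qp x = r x.
  apply/eqP; rewrite eq_sym -subr_eq0; apply/negPn/negP => n0.
  have er : r (r x - qp x) = r x - qp x.
    by rewrite (opB lr) (proj_idem pr) (cut_ep hc).
  have ep : qp (r x - qp x) = 0.
    by rewrite (opB lp) (cut_pe pr hc) (proj_idem (cut_projp hc)) subrr.
  move/(cut_gt hc er ep): n0; have := cK (r x - qp x).
  have := rdot_ge0 dot (r x - qp x); move: (r x - qp x) => w h2.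
  by rewrite ler_norml => /andP[_ h1] h3; nra.
split; apply/funext => x //; rewrite -qpr.
apply/esym/eqP; rewrite -subr_eq0; apply/eqP.
set w := qp x - qm x.
have wp : qp w = w by rewrite /w (opB lp) (proj_idem (cut_projp hc))
  (cut_mp hc).
have wm : qm w = 0.
  by rewrite /w (opB lm) (cut_pm hc) (proj_idem (cut_projm hc)) subrr.
apply: (@rdot_eq0 _ _ dot); have := cK w.
rewrite (cut_eq hc wp wm) rdotZl ler_norml => /andP[_ h1].
exact: (ge0_mul_lt_eq0 (rdot_ge0 dot w) hs).
Qed.

Lemma form_interval_0 : FI 0 0 = [set 0].
Proof.
apply/seteqP; split=> [a [Ma pa _ a0]|_ ->].
  by apply/funext => x; exact: (form_le_proj_kernel pa a0).
split=> //; first exact: vn_0 HM.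
by split=> // [k x y|x y|x]; rewrite ?scaler0 ?addr0 ?rdot0l ?rdot0r.
Qed.

Lemma form_interval_diag : FI r r = [set r].
Proof.
apply/seteqP; split=> [a [Ma pa ra ar]|_ ->]; last first.
  by split=> //; exact: eff_pos (proj_eff pr).
have er := eff_pos (proj_eff pr).
apply/funext; apply: (quadratic_ext (pos_lin pa) (pos_lin er) (pos_sym pa)
  (pos_sym er)).
by move=> x; apply/eqP; rewrite eq_le ra ar.
Qed.

Lemma form_interval_0W p q a :
  form_le dot p q -> FI p q a -> form_le dot q r -> FI 0 r a.
Proof.
move=> pq [Ma pa _ aq] qr; split=> //.
- by move=> v; rewrite /= rdot0l; exact: pos_ge0 pa v.
- by move=> v; exact: le_trans (aq v) (qr v).
Qed.

Lemma form_interval0P a :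
  FI 0 r a <-> [/\ M a, positive_op dot a & form_le dot a r].
Proof.
split=> [[]//|[Ma pa ar]]; split=> // v; rewrite /= rdot0l.
exact: pos_ge0 pa v.
Qed.

Lemma form_interval0_0 : FI 0 r 0.
Proof.
have : FI 0 0 0 by rewrite form_interval_0.
move=> [M0 p0 _ _]; apply/form_interval0P; split=> // v.
by rewrite /= rdot0l; exact: pos_ge0 (eff_pos (proj_eff pr)) v.
Qed.

(** The functional [u = (u0, t)] is [a |-> tau ((b_t - s) a)] with [s = - u0],
    so that its minimizers are those of a shifted trace.  When [t = 0] it is a
    multiple of the trace, whose minimum is attained at a single endpoint of
    [[0, r]]; then any nonzero [t], with [s] outside the spectrum, describes
    that endpoint ([extreme_cuts]). *)
Lemma supported_slice Q (G : set 'rV[R]_n.+1) (u : 'rV[R]_n.+1) (k : R) :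
  M Q -> u != 0 ->
  (forall a, FI 0 r a -> k <= dotrv u (Psi Q + Psi a)) ->
  G = [set Psi Q + Psi a | a in FI 0 r] `&` [set w | dotrv u w = k] ->
  G !=set0 ->
  exists st : R * 'rV[R]_n, st.2 != 0 /\
    G = [set Psi Q + Psi a | a in
          FI (cut_minus dot M r (comb b st.2) st.1)
             (cut_plus dot M r (comb b st.2) st.1)].
Proof.
move=> MQ u0 hk GE [x0]; rewrite GE => -[[a0 Fa0 <-] /= ka0]; rewrite -GE.
have [t0|t0] := eqVneq (tail_row u) 0; last first.
  exists (- u 0 ord0, tail_row u); split=> //=.
  set t := tail_row u in t0 *; set s := - u 0 ord0.
  have hc := stage_cut t s.
  set qm := cut_minus _ _ _ _ _ in hc *; set qp := cut_plus _ _ _ _ _ in hc *.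
  have uE a : FI 0 r a -> dotrv u (Psi Q + Psi a) =
      dotrv u (Psi Q) + shifted_trace tau (compr t) s a.
    move=> Fa; have [Ma _ _ _] := Fa; rewrite dotrvD (dotrv_Psi u Ma).
    by rewrite rtrace_compress ?inE // /shifted_trace /s mulNr opprK.
  have Fqm : FI 0 r qm.
    apply/form_interval0P; split; first exact: proj_mem (cut_projm hc).
    - exact: eff_pos (proj_eff (cut_projm hc)).
    - exact: (cut_form_lem pr hc).
  have min a : FI 0 r a -> shifted_trace tau (compr t) s qm <=
      shifted_trace tau (compr t) s a.
    move=> /form_interval0P[Ma pa ar].
    exact: (shifted_trace_min HM Htau pr (compr_mem t) (compr_sym t)
      (compr_r t) (r_compr t) hc).
  have kE : dotrv u (Psi Q) + shifted_trace tau (compr t) s qm = k.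
    have := hk qm Fqm; have := min a0 Fa0; move: ka0.
    by rewrite uE // uE //; lra.
  rewrite GE; apply/seteqP; split=> [_ [[a Fa <-] /= ka]|_ [a Fa <-]].
    exists a => //; have [Ma pa ar] := (form_interval0P a).1 Fa.
    have fa : shifted_trace tau (compr t) s a = shifted_trace tau
      (compr t) s qm.
      by move: ka; rewrite uE // -kE; lra.
    have [h1 h2] := shifted_trace_argmin HM Htau pr (compr_mem t) (compr_sym t)
      (compr_r t) (r_compr t) hc Ma pa ar fa.
    by split.
  have [Ma pa ma ap] := Fa.
  have Fa' : FI 0 r a.
    exact: form_interval_0W (cut_form_le hc) Fa (cut_form_lep pr hc).
  split; first by exists a.
  rewrite /= uE // (shifted_trace_argminW HM Htau pr (compr_mem t)
      (compr_r t) (r_compr t) hc Ma pa ma ap) //.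
pose t1 : 'rV[R]_n := const_mx 1.
have t1_neq0 : t1 != 0.
  apply/eqP => /rowP /(_ (Ordinal n_gt0)); rewrite !mxE => /eqP.
  by rewrite oner_eq0.
have uE a : M a -> dotrv u (Psi Q + Psi a) = dotrv u (Psi Q) + u 0 ord0 * T a.
  move=> Ma; rewrite dotrvD (dotrv_Psi u Ma) t0.
  have -> : comb b 0 = 0.
    rewrite /comb big1 // => i _; rewrite mxE.
    by rewrite -[_%:C]/(0 : R[i]) scale0r.
  have -> : 0 \o a = 0 by [].
  by rewrite (rtrace0 HM Htau) add0r.
have [K K0 [Klow Khigh]] := extreme_cuts t1.
have FM a : FI 0 r a -> M a by case.
have u00 : u 0 ord0 != 0.
  apply: contra_neq u0 => u00; apply/rowP => j; rewrite mxE.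
  case: (unliftP ord0 j) => [i ->|->] //.
  by move/rowP: t0 => /(_ i); rewrite !mxE.
have Tr a : FI 0 r a -> 0 <= T a <= T r.
  move=> /form_interval0P[Ma pa ar]; rewrite (rtrace_ge0 Htau Ma pa) /=.
  rewrite -subr_ge0 -(rtraceB HM Htau) //; apply: (rtrace_ge0 Htau).
    exact: (vn_sub HM).
  apply: eff_pos; apply: effect_sub => //; first exact: proj_eff pr.
  split=> // v; apply: le_trans (ar v) _; exact: eff_le1 (proj_eff pr) v.
have M0 := vn_0 HM.
have T0 := rtrace0 HM Htau.
have Fr : FI 0 r r.
  by apply/form_interval0P; split=> //; exact: eff_pos (proj_eff pr).
have [upos|uneg] := ltP 0 (u 0 ord0).
  exists (- (K + 1), t1); split=> //=.
  have [|-> ->] := Klow (- (K + 1)); first by lra.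
  rewrite form_interval_0.
  have kE : dotrv u (Psi Q) = k.
    have := hk 0 form_interval0_0; move: ka0;
      rewrite (uE _ (FM _ Fa0)) (uE _ M0) T0 => ka0.
    have /andP[h _] := Tr a0 Fa0; have := mulr_ge0 (ltW upos) h; lra.
  rewrite GE; apply/seteqP; split=> [_ [[a Fa <-] /= ka]|_ [_ -> <-]].
    exists a => //=; have [Ma pa ar] := (form_interval0P a).1 Fa.
    apply: (rtrace_faithful Htau Ma pa).
    move: ka; rewrite uE // kE => /eqP; rewrite -subr_eq0 addrAC subrr add0r.
    by rewrite mulf_eq0 (negbTE u00) => /eqP.
  by split; [exists 0 => //;
    exact: form_interval0_0|rewrite /= uE // T0 mulr0 addr0].
have {}uneg : u 0 ord0 < 0 by rewrite lt_def eq_sym u00.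
exists (K + 1, t1); split=> //=.
have [|-> ->] := Khigh (K + 1); first by lra.
rewrite form_interval_diag.
have kE : dotrv u (Psi Q) + u 0 ord0 * T r = k.
  have := hk r Fr; move: ka0; rewrite (uE _ (FM _ Fa0)) (uE _ Mr) => ka0.
  have /andP[_ h] := Tr a0 Fa0; nra.
rewrite GE; apply/seteqP; split=> [_ [[a Fa <-] /= ka]|_ [_ -> <-]].
  exists a => //=; have [Ma pa ar] := (form_interval0P a).1 Fa.
  have Tra : T (r - a) = 0.
    rewrite (rtraceB HM Htau) //; move: ka; rewrite uE // -kE => /eqP.
    rewrite -subr_eq0 opprD addrACA subrr add0r -mulrBr mulf_eq0 (negbTE u00).
    by rewrite subr_eq0 => /eqP->; rewrite subrr.
  have pra : positive_op dot (r - a).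
    apply: eff_pos; apply: effect_sub => //; first exact: proj_eff pr.
    split=> // v; apply: le_trans (ar v) _; exact: eff_le1 (proj_eff pr) v.
  have := rtrace_faithful Htau (vn_sub HM Mr Ma) pra Tra.
  by move/eqP; rewrite subr_eq0 => /eqP.
by split; [exists r|rewrite /= uE].
Qed.

Lemma exposed_face_cut Q (G : set 'rV[R]_n.+1) : M Q ->
  exposed_face G [set Psi Q + Psi a | a in FI 0 r] ->
  exists st : R * 'rV[R]_n, st.2 != 0 /\
    G = [set Psi Q + Psi a | a in
          FI (cut_minus dot M r (comb b st.2) st.1)
             (cut_plus dot M r (comb b st.2) st.1)].
Proof.
move=> MQ [_ G0 [P [u [k [u0 -> _ side]]] GE]].
case: side => side; last first.
  apply: (@supported_slice Q G u k) => // a Fa.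
  by apply: side; exists a.
apply: (@supported_slice Q G (- u) (- k)) => //.
- by rewrite oppr_eq0.
- by move=> a Fa; rewrite dotrvN lerN2; apply: side; exists a.
rewrite GE; congr (_ `&` _); apply/seteqP; split=> w /=.
  by rewrite /hyperplane /= dotrvN => ->.
by rewrite /hyperplane /= dotrvN => /oppr_inj.
Qed.

End stage.
End Scale.

(** * The facial chain *)

Section Shift.
Local Open Scope complex_scope.
Context {R : realType} {H : completeNormedModType R[i]}.
Variable dot : {dot H for @Num.conj R[i]}.
Variable M : set (H -> H).
Hypothesis HM : von_neumann_algebra dot M.
Implicit Types (a p q : H -> H).
Local Notation rd := (rdot dot).
Local Notation FI := (form_interval dot M).

Lemma form_interval_shift p p1 q1 : M p -> positive_op dot p ->
  form_le dot 0 p1 ->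
  FI (p + p1) (p + q1) = [set p + a | a in FI p1 q1].
Proof.
move=> Mp pp p10; have [lp sp p0] := pp.
apply/seteqP; split=> [a [Ma pa l u]|_ [a [Ma pa l u] <-]].
  have [la sa a0] := pa; exists (a - p); last by rewrite addrC subrK.
  have h1 v : rd (p1 v) v <= rd ((a - p) v) v.
    by have := l v; rewrite op_addE op_subE !rdotDl !rdotNl; lra.
  split=> //; first exact: (vn_sub HM).
  - split; first by apply: (vn_linear HM); exact: (vn_sub HM).
    + by move=> x y; rewrite !op_subE !rdotE sa sp.
    + by move=> x; have := p10 x; rewrite rdot0l => h; exact: le_trans (h1 x).
  - by move=> v; have := u v; rewrite op_addE op_subE !rdotDl !rdotNl; lra.
split; first exact: (vn_add HM).
- exact: positive_add.
- by move=> v; rewrite !op_addE !rdotDl lerD2l.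
- by move=> v; rewrite !op_addE !rdotDl lerD2l.
Qed.

Lemma p_minusE n (b : 'I_n -> H -> H) s t :
  p_minus dot M b s t = cut_minus dot M idfun (comb b t) s.
Proof. by rewrite /cut_minus corner_id. Qed.

Lemma p_plusE n (b : 'I_n -> H -> H) s t :
  p_plus dot M b s t = cut_plus dot M idfun (comb b t) s.
Proof. by rewrite /cut_plus corner_id. Qed.

End Shift.

Theorem theorem3p6 (R : realType) (H : completeNormedModType R[i])
    (dot : {dot H for @Num.conj R[i]}) (Hdot : norm_from_dot dot)
    (M : set (H -> H)) (HM : von_neumann_algebra dot M)
    (Mfin : finite_algebra dot M)
    (tau : (H -> H) -> R[i]) (Htau : faithful_normal_tracial_state dot M tau)
    (n : nat) (n_gt0 : (0 < n)%N)
    (b : 'I_n -> H -> H) (Mb : forall i, M (b i))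
    (sab : forall i, selfadjoint dot (b i))
    (F : set 'rV[R]_n.+1) (F_neq0 : F !=set0)
    (F_face : face F (spectral_scale dot M tau b))
    (F_bd : F `<=` boundary (spectral_scale dot M tau b))
    (k : nat) (Fs : nat -> set 'rV[R]_n.+1)
    (F_chain : minimal_exposed_chain (spectral_scale dot M tau b) F k Fs) :
  exists st : nat -> R * 'rV[R]_n,
    [/\ has_facial_complex dot M b st k,
        Fs 1%N = Psi tau b @` op_interval dot M
                   (p_minus dot M b (st 1%N).1 (st 1%N).2)
                   (p_plus dot M b (st 1%N).1 (st 1%N).2)
      & forall i, (2 <= i <= k)%N ->
          Fs i = Psi tau b @` op_interval dot M
                   (sum_qminus dot M b st i) (sum_qplus dot M b st i) /\
          Fs i = [set Psi tau b (sum_qminus dot M b st i.-1) + y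
                   | y in Psi tau b @` op_interval dot M
                            (fc_qminus dot M b st i) (fc_qplus dot M b st i)]].
Proof.
have [k_gt0 _ [F1_exp _ _] chain] := F_chain.
pose FI := form_interval dot M.
pose cm r (z : R * 'rV[R]_n) := cut_minus dot M r (comb b z.2) z.1.
pose cp r (z : R * 'rV[R]_n) := cut_plus dot M r (comb b z.2) z.1.
have [f hf] : exists f : (H -> H) * (H -> H) * set 'rV[R]_n.+1 -> R * 'rV[R]_n,
    forall rQG, proj_of dot M rQG.1.1 -> M rQG.1.2 ->
      exposed_face rQG.2 [set Psi tau b rQG.1.2 + Psi tau b a | a in FI 0
        rQG.1.1] ->
      (f rQG).2 != 0 /\ rQG.2 = [set Psi tau b rQG.1.2 + Psi tau b a | a in
          FI (cm rQG.1.1 (f rQG)) (cp rQG.1.1 (f rQG))].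
  suff /choice[f hf] : forall rQG : (H -> H) * (H -> H) * set 'rV[R]_n.+1,
      exists z : R * 'rV[R]_n, proj_of dot M rQG.1.1 -> M rQG.1.2 ->
      exposed_face rQG.2 [set Psi tau b rQG.1.2 + Psi tau b a | a in FI 0
        rQG.1.1] ->
      z.2 != 0 /\ rQG.2 = [set Psi tau b rQG.1.2 + Psi tau b a | a in
          FI (cm rQG.1.1 z) (cp rQG.1.1 z)] by exists f.
  move=> [[r Q] G] /=.
  have [[pr MQ Gexp]|no] := pselect [/\ proj_of dot M r, M Q &
      exposed_face G [set Psi tau b Q + Psi tau b a | a in FI 0 r]].
    have [z hz] := exposed_face_cut Hdot HM Htau n_gt0 Mb sab pr MQ Gexp.
    by exists z.
  (* Inadmissible triples get an arbitrary value. *)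
  by exists (0, 0) => *; exfalso; apply: no.
(* With [S i = (r, Q)], the [i]-th face is [Psi Q + Psi [0, r]]; the next
   spectral pair is chosen from [r], [Q] and the next face. *)
pose step i (rQ : (H -> H) * (H -> H)) :=
  let z := f (rQ, Fs i.+1) in (cp rQ.1 z - cm rQ.1 z, rQ.2 + cm rQ.1 z).
pose S i := iteri i step (idfun, 0).
pose st i := f (S i.-1, Fs i).
(* The chain, preceded by the whole scale. *)
pose C i := if i is 0%N then spectral_scale dot M tau b else Fs i.
have S1 i : (S i.+1).1 = cp (S i).1 (st i.+1) - cm (S i).1 (st i.+1) by [].
have S2 i : (S i.+1).2 = (S i).2 + cm (S i).1 (st i.+1) by [].
have rE i : fc_r dot M b st i = (S i).1.
  case: i => // i; elim: i => [|i IH];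
    first by rewrite /fc_r p_plusE // p_minusE.
  by rewrite S1 -IH.
have qmE i : fc_qminus dot M b st i.+1 = cm (S i).1 (st i.+1).
  by rewrite /fc_qminus rE.
have qpE i : fc_qplus dot M b st i.+1 = cp (S i).1 (st i.+1).
  by rewrite /fc_qplus rE.
have sumE i : sum_qminus dot M b st i.+1 = (S i.+1).2.
  elim: i => [|i IH].
    by rewrite /sum_qminus big_geq // addr0 p_minusE // S2 add0r.
  by rewrite S2 -IH -qmE /sum_qminus big_nat_recr //= addrA.
have sumpE i : sum_qplus dot M b st i.+2 = (S i.+1).2 + cp (S i.+1).1 (st i.+2).
  by rewrite /sum_qplus -qpE -sumE.
have expo i : (i < k)%N -> exposed_face (Fs i.+1) (C i).
  by case: i => // i ik; have [|[]] := chain i.+2; rewrite ?ik.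
have cutS i : proj_of dot M (S i).1 -> cut_spec dot M (S i).1
    ((S i).1 \o comb b (st i.+1).2 \o (S i).1) (st i.+1).1
    (cm (S i).1 (st i.+1)) (cp (S i).1 (st i.+1)).
  by move=> pr; have := stage_cut Hdot HM Mb sab pr (st i.+1).2 (st i.+1).1.
have Csucc i : (i < k)%N -> proj_of dot M (S i).1 -> M (S i).2 ->
    C i = [set Psi tau b (S i).2 + Psi tau b a | a in FI 0 (S i).1] ->
    (st i.+1).2 != 0 /\ Fs i.+1 = [set Psi tau b (S i).2 + Psi tau b a | a in
       FI (cm (S i).1 (st i.+1)) (cp (S i).1 (st i.+1))].
  move=> ik pr MQ CE; have := expo i ik; rewrite CE => ex.
  exact: (hf (S i, Fs i.+1) pr MQ ex).
(* [Q + r <= 1] keeps the translated order intervals below the unit. *)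
have inv i : (i <= k)%N -> [/\ proj_of dot M (S i).1, M (S i).2,
    positive_op dot (S i).2, form_le dot ((S i).2 + (S i).1) idfun &
    C i = [set Psi tau b (S i).2 + Psi tau b a | a in FI 0 (S i).1]].
  elim: i => [_|i IH ik].
    have M0 := vn_0 HM.
    have p0 : positive_op dot (0 : H -> H).
      by split=> [l x y|x y|x]; rewrite /= ?scaler0 ?addr0 ?rdot0l ?rdot0r.
    have pid := proj_of_idfun HM.
    split=> //=; first by move=> v; rewrite add0r.
    have -> : FI 0 idfun = op_interval dot M 0 idfun.
      rewrite op_intervalE //; first exact: pos_sym p0.
      exact: vn_id HM.
    rewrite /spectral_scale.
    have -> : op_interval dot M 0 idfun = unit_interval_op dot M.
      apply/seteqP; split=> [a []//|a [Ma pa a1]].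
      by split=> //; rewrite /le_op subr0.
    apply/seteqP; split=> [_ [a ua <-]|_ [a ua <-]]; exists a => //.
      by rewrite (Psi0 HM Htau Mb) add0r.
    by rewrite (Psi0 HM Htau Mb) add0r.
  have [pr MQ pQ Q1 CE] := IH (ltnW ik).
  have hc := cutS i pr.
  have [_ FE] := Csucc i ik pr MQ CE.
  have hm := cut_projm hc; have hp := cut_projp hc.
  rewrite S1 S2; set qm := cm _ _ in hc hm FE *; set qp := cp _ _ in hc hp FE *.
  split.
  - have le := cut_form_le hc; split.
    + exact: (vn_sub HM (proj_mem hp) (proj_mem hm)).
    + exact: (effect_sub (proj_eff hp) (proj_eff hm)).
    move=> x; have lm := pos_lin (proj_eff hm);
      have lp := pos_lin (proj_eff hp).
    have dE z : (qp - qm) z = qp z - qm z by [].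
    rewrite !dE (opB lm) (opB lp) (proj_idem hp) (proj_idem hm).
    by rewrite (cut_mp hc) (cut_pm hc) subrr subr0.
  - exact: (vn_add HM MQ (proj_mem hm)).
  - exact: positive_add pQ (eff_pos (proj_eff hm)).
  - move=> v; apply: le_trans (Q1 v).
    have := cut_form_lep pr hc v.
    have -> : ((S i).2 + qm + (qp - qm)) v = (S i).2 v + qm v + (qp v - qm v).
      by [].
    have -> : ((S i).2 + (S i).1) v = (S i).2 v + (S i).1 v by [].
    rewrite !rdotDl !rdotNl; lra.
  rewrite /C FE.
  have qE : FI qm qp = [set qm + a | a in FI 0 (qp - qm)].
    rewrite /FI -(form_interval_shift HM) ?addr0 1?[qm + _]addrC ?subrK //.
    - exact: proj_mem hm.
    - exact: eff_pos (proj_eff hm).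
  have PsiE a : FI 0 (qp - qm) a ->
      Psi tau b (S i).2 + Psi tau b (qm + a) =
      Psi tau b ((S i).2 + qm) + Psi tau b a.
    move=> [Ma _ _ _]; rewrite (PsiD HM Htau Mb (proj_mem hm) Ma).
    by rewrite (PsiD HM Htau Mb MQ (proj_mem hm)) addrA.
  rewrite qE; apply/seteqP; split=> [_ [_ [a Fa <-] <-]|_ [a Fa <-]].
    by exists a => //; rewrite PsiE.
  by exists (qm + a); [exists a|rewrite PsiE].
have intE i : (i < k)%N ->
    FI (cm (S i).1 (st i.+1)) (cp (S i).1 (st i.+1)) =
    op_interval dot M (cm (S i).1 (st i.+1)) (cp (S i).1 (st i.+1)).
  move=> ik; have [pr _ _ _ _] := inv i (ltnW ik).
  have hc := cutS i pr; have hm := cut_projm hc; have hp := cut_projp hc.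
  rewrite op_intervalE //.
  - exact: proj_mem hm.
  - exact: pos_sym (proj_eff hm).
  - exact: proj_mem hp.
  - exact: pos_sym (proj_eff hp).
  - exact: eff_le1 (proj_eff hp).
exists st; split.
- split=> [[//|i] /= ik|i i_gt0 ik].
    have [pr MQ _ _ CE] := inv i (ltnW ik).
    exact: (Csucc i ik pr MQ CE).1.
  have ik' : (i < k)%N by rewrite ltnW.
  have [pr MQ _ _ CE] := inv i (ltnW ik').
  have hc := cutS i pr; have hm := cut_projm hc; have hp := cut_projp hc.
  have [pr' MQ' _ _ CE'] := inv i.+1 ik'.
  rewrite !rE; split.
    apply: (form_le_op HM (proj_mem pr') (proj_mem pr)).
    + exact: pos_sym (proj_eff pr').
    + exact: pos_sym (proj_eff pr).
    move=> v; have h : rdot dot (cp (S i).1 (st i.+1) v - cm (S i).1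
      (st i.+1) v) v <=
        rdot dot ((S i).1 v) v.
      rewrite rdotDl rdotNl; have := cut_form_lep pr hc v.
      by have := pos_ge0 (eff_pos (proj_eff hm)) v; lra.
    exact: h.
  (* If [r] did not decrease, then [qm = 0] and the face would not shrink. *)
  move=> e; have qm0 : cm (S i).1 (st i.+1) = 0.
    apply/funext => x; set y := cm (S i).1 (st i.+1) x.
    have : cp (S i).1 (st i.+1) y - cm (S i).1 (st i.+1) y = (S i).1 y.
      exact: (congr1 (@^~ y) e).
    by rewrite (cut_mp hc) (proj_idem hm) subrr (cut_em hc) => /esym.
  have CC : C i.+1 = C i by rewrite CE' CE e S2 qm0 addr0.
  have [|_ []] := chain i.+1; first by rewrite ltnS i_gt0.
  move=> _; case: i i_gt0 CC {ik ik' pr MQ CE hc hm hp pr' MQ' CE' e qm0} => //.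
  by move=> i _ /= <-; apply.
- have [pr MQ _ _ CE] := inv 0%N isT.
  have [_ ->] := Csucc 0%N k_gt0 pr MQ CE.
  rewrite intE // p_minusE // p_plusE //.
  by apply/seteqP; split=> [_ [a ua <-]|_ [a ua <-]]; exists a => //;
    rewrite (Psi0 HM Htau Mb) add0r.
move=> [|[|i]] // /andP[_ ik].
have [pr MQ pQ Q1 CE] := inv i.+1 (ltnW ik).
have hc := cutS i.+1 pr; have hm := cut_projm hc; have hp := cut_projp hc.
have [_ FE] := Csucc i.+1 ik pr MQ CE.
split; last first.
  rewrite FE sumE qmE qpE -intE //; apply/seteqP.
  split=> [_ [a Fa <-]|_ [_ [a Fa <-] <-]]; last by exists a.
  by exists (Psi tau b a) => //; exists a.
rewrite sumpE sumE S2 FE.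
set qm := cm _ _ in hc hm *; set qp := cp _ _ in hc hp *.
have MQm := vn_add HM MQ (proj_mem hm).
have MQp := vn_add HM MQ (proj_mem hp).
rewrite op_intervalE //; first last.
- move=> v; apply: le_trans (Q1 v).
  have h : rdot dot ((S i.+1).2 v + qp v) v <=
      rdot dot ((S i.+1).2 v + (S i.+1).1 v) v.
    rewrite rdotDl [leRHS]rdotDl lerD2l; exact: (cut_form_lep pr hc v).
  exact: h.
- exact: pos_sym (positive_add pQ (eff_pos (proj_eff hp))).
- exact: pos_sym (positive_add pQ (eff_pos (proj_eff hm))).
rewrite (form_interval_shift HM) //; last first.
  by move=> v; rewrite rdot0l; exact: pos_ge0 (eff_pos (proj_eff hm)) v.
apply/seteqP; split=> [_ [a Fa <-]|_ [_ [a Fa <-] <-]].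
  exists ((S i.+1).2 + a); first by exists a.
  by case: Fa => Ma _ _ _; rewrite (PsiD HM Htau Mb MQ Ma).
by exists a => //; case: Fa => Ma _ _ _; rewrite (PsiD HM Htau Mb MQ Ma).
Qed.
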